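(* Let $\mathsf{N}_n$ be a uniformly random simplex tree-child network with $n$ taxa, and let $v_n$ be chosen uniformly at random among all vertices of $\mathsf{N}_n$. Then $(\mathsf{N}_n,v_n)\xrightarrow{d}(N^*,v^* )$ in the local weak sense as $n\to\infty$, where $(N^*,v^* )$ is the random rooted network equal to $$(\hat{\mathcal{L}},p_0)\text{ with probability }\tfrac12,\qquad(\hat{\mathcal{R}},\rho_0)\text{ with probability }\tfrac14,\qquad(\hat{\mathsf{N}}^{\mathrm{lf}},\ell_0)\text{ with probability }\tfrac14 .$$ The weights $\tfrac12,\tfrac14,\tfrac14$ are the asymptotic (as $n\to\infty$) proportions of tree vertices, reticulation vertices and leaves, respectively, among the total number of vertices of $\mathsf{N}_n$.
   Context: A simplex tree-child network on a finite set $X$ is a finite directed acyclic graph $N=(V,E)$ with a root $o$ and with leaves bijectively labelled by $X$, such that: the root has (indegree, outdegree) $=(0,1)$; every vertex is reachable from $o$ by a directed path; every leaf has degree $(1,0)$; every vertex that is neither the root nor a leaf is either a tree vertex, of degree $(1,2)$, or a reticulation vertex, of degree $(2,1)$; (tree-child) every non-leaf vertex has at least one child that is a tree vertex or a leaf; (one-component) the unique child of every reticulation vertex is a leaf. Networks are considered up to isomorphism preserving leaf labels. $\mathsf{N}_n$ is uniform on the finite set of simplex tree-child networks with leaf label set $[n]$. Local neighbourhoods: for a directed graph $N$ and $v\in V(N)$, $U_R(N,v)$ is the subgraph induced by the vertices at undirected graph distance at most $R$ from $v$, rooted at $v$. Each vertex carries a mark giving its type in $N$ (root, tree vertex, reticulation,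 or leaf); leaf labels are ignored. $\cong$ denotes isomorphism of rooted directed marked graphs, i.e. a bijection of vertex sets preserving root, marks, edges and edge orientations. Local weak convergence $(N_n,v_n)\xrightarrow{d}(N,v)$ means $\mathbb{P}(U_R(N_n,v_n)\cong G)\to\mathbb{P}(U_R(N,v)\cong G)$ for every fixed $R\ge0$ and every finite rooted directed marked graph $G$. Limit networks (deterministic). A bi-infinite spine is a bi-infinite directed path $\cdots\to x_{-1}\to x_0\to x_1\to\cdots$ of tree vertices. To decorate a tree vertex $x$ means: give $x$ a new reticulation child $\rho(x)$; give $\rho(x)$ a new leaf child $\ell(x)$; and give $\rho(x)$ a second parent $w(x)$, which is a tree vertex on a new bi-infinite spine, all of whose vertices other than $w(x)$ are in turn decorated, recursively (the reticulation child of $w(x)$ is $\rho(x)$). All spines and vertices introduced at every level are pairwise distinct. - $\hat{\mathcal{L}}$ is a bi-infinite spine $\cdots\to p_{-1}\to p_0\to p_1\to\cdots$ all of whose vertices are decorated, rooted at $p_0$. - $\hat{\mathcal{R}}$ has two disjoint bi-infinite spines $(p_i)_{i\in\mathbb{Z}}$ and $(q_i)_{i\in\mathbb{Z}}$, and a reticulation $\rho_0$ whose two parents are $p_0$ and $q_0$ and whose only child is a leaf $\ell_0$; every $p_i,q_i$ with $i\ne0$ is decorated, while $p_0,q_0$ have $\rho_0$ as their only reticulation child. It is rooted at $\rho_0$. - $\hat{\mathsf{N}}^{\mathrm{lf}}$ is the same directed graph as $\hat{\mathcal{R}}$, rooted at $\ell_0$ instead. *)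

(* Defs.v *)
From HB Require Import structures.
From mathcomp Require Import all_boot all_order all_algebra.
From mathcomp Require Import all_classical all_reals all_analysis.
From mathcomp Require Import zify.

Set Implicit Arguments.
Unset Strict Implicit.
Unset Printing Implicit Defensive.

Import Order.TTheory GRing.Theory Num.Theory.
Import numFieldNormedType.Exports.

Local Open Scope ring_scope.
Local Open Scope classical_set_scope.

(** * Rooted directed marked graphs and local weak convergence *)

Inductive vmark := MRoot | MTree | MRet | MLeaf.

Record rgraph := RGraph {
  gvert : Type;
  gedge : gvert -> gvert -> Prop;
  gmark : gvert -> vmark;
  groot : gvert
}.

(* [within G r x y]: the distance from x to y is at most r, orientations of
   the edges being ignored. *)
Fixpoint within (G : rgraph) (r : nat) (x y : gvert G) : Prop :=
  if r is r'.+1 then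
    x = y \/ exists z, (gedge x z \/ gedge z x) /\ within r' z y
  else x = y.

Lemma within_refl (G : rgraph) r (x : gvert G) : within r x x.
Proof. by case: r => [//|r]; left. Qed.

(* [ball r G] is U_r(G, root); marks are the types in the whole of G. *)
Definition ball (r : nat) (G : rgraph) : rgraph :=
  @RGraph {x : gvert G | within r (groot G) x}
    (fun x y => gedge (sval x) (sval y))
    (fun x => gmark (sval x))
    (exist _ (groot G) (within_refl r (groot G))).

Definition rgraph_iso (G H : rgraph) : Prop :=
  exists f : gvert G -> gvert H,
    [/\ bijective f,
        f (groot G) = groot H,
        forall x, gmark (f x) = gmark x &
        forall x y, gedge (f x) (f y) <-> gedge x y].

Definition rgraph_finite (G : rgraph) : Prop := finite_set [set: gvert G].

(* The law of a random rooted graph is given by the map sending an event to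
   its probability.  Events are not of type [set rgraph]: with the universe
   constraints this adds, no [finType] could be used as a vertex type. *)
Definition local_weak_cvg (R : realType)
    (P_ : nat -> (rgraph -> Prop) -> R) (P : (rgraph -> Prop) -> R) : Prop :=
  forall (r : nat) (G : rgraph), rgraph_finite G ->
    P_ n (fun H => rgraph_iso (ball r H) G) @[n --> \oo]
      --> P (fun H => rgraph_iso (ball r H) G).

(** * Simplex tree-child networks *)

Section Network.
Variables (n : nat) (V : finType).
Variables (e : rel V) (o : V) (lab : 'I_n -> V).

Definition indeg (v : V) : nat := #|[pred u | e u v]|.
Definition outdeg (v : V) : nat := #|[pred w | e v w]|.

Definition has_deg (v : V) (i j : nat) : bool :=
  (indeg v == i) && (outdeg v == j).

Definition is_tree (v : V) : bool := has_deg v 1 2.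
Definition is_ret (v : V) : bool := has_deg v 2 1.
Definition is_leaf (v : V) : bool := v \in codom lab.

Definition acyclic : Prop := forall x y, e x y -> ~~ connect e y x.

(* Simple digraphs suffice: a pair of parallel edges could only go from a tree
   vertex to a reticulation, which the tree-child condition excludes. *)
Record simplex_tree_child : Prop := {
  stc_acyclic : acyclic;
  stc_root_deg : has_deg o 0 1;
  stc_reach : forall v, connect e o v;
  stc_lab_inj : injective lab;
  stc_leaf_deg : forall v, is_leaf v -> has_deg v 1 0;
  stc_inner_deg : forall v, v != o -> ~~ is_leaf v -> is_tree v || is_ret v;
  stc_tree_child : forall v, ~~ is_leaf v ->
    exists2 w, e v w & is_tree w || is_leaf w;
  stc_one_component : forall v w, is_ret v -> e v w -> is_leaf w
}.

Definition vtype (v : V) : vmark :=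
  if v == o then MRoot
  else if is_leaf v then MLeaf
  else if is_ret v then MRet
  else MTree.

Lemma sum_indeg_outdeg : (\sum_v indeg v = \sum_v outdeg v)%N.
Proof.
rewrite (eq_bigr (fun v => \sum_u e u v)%N); last first.
  by move=> v _; rewrite /indeg -sum1_card big_mkcond; apply: eq_bigr => u _;
     rewrite inE; case: (e u v).
rewrite [RHS](eq_bigr (fun v => \sum_u e v u)%N); last first.
  by move=> v _; rewrite /outdeg -sum1_card big_mkcond; apply: eq_bigr => u _;
     rewrite inE; case: (e v u).
exact: exchange_big.
Qed.

(* Hence there are finitely many networks on n taxa up to isomorphism. *)
Lemma stc_card_le : simplex_tree_child -> (#|V| <= 4 * n)%N.
Proof.
move=> [_ ro _ injl lfd ind _ one].
have card_leaf : (\sum_v is_leaf v = n)%N.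
  rewrite -[RHS]card_ord -(card_codom injl) -sum1_card [RHS]big_mkcond /=.
  by apply: eq_bigr => v _; rewrite /is_leaf; case: (v \in codom lab).
have sum_root : (\sum_v (v == o) = 1)%N.
  by rewrite (bigD1 o) //= eqxx big1 // => v /negbTE ->.
have loc v : [/\ indeg v = (is_leaf v + is_tree v + 2 * is_ret v)%N,
    outdeg v = ((v == o) + 2 * is_tree v + is_ret v)%N &
    1%N = ((v == o) + is_leaf v + is_tree v + is_ret v)%N].
  have := ind v; have := lfd v; rewrite /is_tree /is_ret /has_deg.
  have [->|vo] := eqVneq v o.
    move: ro; rewrite /has_deg => /andP[/eqP -> /eqP ->] /=.
    by case: (is_leaf o) => // /(_ isT).
  case: (is_leaf v) => /= [/(_ isT)/andP[/eqP -> /eqP ->] _ //|_ /(_ isT isT)].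
  by case/orP => /andP[/eqP -> /eqP ->].
have Hc : (#|V| = \sum_v (v == o) + \sum_v is_leaf v + \sum_v is_tree v
                  + \sum_v is_ret v)%N.
  rewrite -!big_split /= -sum1_card; apply: eq_bigr => v _.
  by have [_ _ {1}->] := loc v.
have Hi : (\sum_v indeg v = \sum_v is_leaf v + \sum_v is_tree v
                  + 2 * \sum_v is_ret v)%N.
  rewrite big_distrr -!big_split /=; apply: eq_bigr => v _.
  by have [-> _ _] := loc v.
have Ho : (\sum_v outdeg v = \sum_v (v == o) + 2 * \sum_v is_tree v
                  + \sum_v is_ret v)%N.
  rewrite big_distrr -!big_split /=; apply: eq_bigr => v _.
  by have [_ -> _] := loc v.
have Hr : (\sum_v is_ret v <= \sum_v is_leaf v)%N.
  have -> : (\sum_v is_ret v = \sum_v \sum_w (is_ret v && e v w))%N.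
    apply: eq_bigr => v _; case rv: (is_ret v) => /=; last by rewrite big1.
    move/andP: rv => [_ /eqP <-]; rewrite /outdeg -sum1_card big_mkcond.
    by apply: eq_bigr => w _; rewrite inE; case: (e v w).
  rewrite exchange_big /=; apply: leq_sum => w _.
  case lw: (is_leaf w); last first.
    rewrite big1 // => v _; apply/eqP; rewrite eqb0.
    by apply/negP => /andP[rv evw]; rewrite (one _ _ rv evw) in lw.
  have /andP[/eqP ind1 _] := lfd _ lw; rewrite -[leqRHS]/1%N -ind1.
  rewrite /indeg -sum1_card [leqRHS]big_mkcond; apply: leq_sum => v _.
  by rewrite inE; case: (e v w); rewrite ?andbF ?andbT //; case: is_ret.
have := sum_indeg_outdeg; lia.
Qed.

End Network.

(** * The uniform random network *)

(* By [stc_card_le] every network on n taxa has an isomorphic copy with vertex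
   set 'I_m for some m <= 4n: m, the edge set, the root, the leaf labels. *)
Definition prenet (n : nat) : Type :=
  {m : 'I_(4 * n).+1 &
    ({set 'I_m * 'I_m} * 'I_m * {ffun 'I_n -> 'I_m})%type}.

HB.instance Definition _ n := Finite.on (prenet n).

Section Prenet.
Variables (n : nat) (N : prenet n).

Definition nvert : finType := 'I_(tag N).
Definition nedge : rel nvert := fun x y => (x, y) \in (tagged N).1.1.
Definition nroot : nvert := (tagged N).1.2.
Definition nlab : 'I_n -> nvert := (tagged N).2.

Definition is_network : Prop := simplex_tree_child nedge nroot nlab.

Definition ntype (v : nvert) : vmark := vtype nedge nroot nlab v.

Definition rooted_net (v : nvert) : rgraph :=
  @RGraph nvert (fun x y => nedge x y) ntype v.

End Prenet.

Definition net_iso (n : nat) (N M : prenet n) : Prop :=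
  exists f : nvert N -> nvert M,
    [/\ bijective f,
        f (nroot N) = nroot M,
        forall i, f (nlab N i) = nlab M i &
        forall x y, nedge (f x) (f y) = nedge x y].

(* One representative of each isomorphism class of networks. *)
Definition networks (n : nat) : {set prenet n} :=
  let D := [set N : prenet n | `[< is_network N >]]%SET in
  transversal (equivalence_partition (fun N M => `[< net_iso N M >]) D) D.

Section Laws.
Variable R : realType.

Definition net_mean (n : nat) (f : prenet n -> R) : R :=
  (\sum_(N in networks n) f N) / #|networks n|%:R.

Definition net_prob (n : nat) (E : set (prenet n)) : R :=
  net_mean (fun N => \1_E N).

(* The law of (N_n, v_n). *)
Definition random_vertex_law (n : nat) (E : rgraph -> Prop) : R :=
  net_mean (fun N : prenet n =>
    (\sum_(v : nvert N) `[< E (rooted_net v) >]%:R) / #|nvert N|%:R).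

Definition type_proportion (t : vmark) (n : nat) (N : prenet n) : R :=
  #|[pred v : nvert N | `[< ntype v = t >]]|%:R / #|nvert N|%:R.

(* Convergence in probability, to a constant, of a statistic of N_n. *)
Definition cvg_in_prob (X : forall n, prenet n -> R) (c : R) : Prop :=
  forall eps : R, 0 < eps ->
    net_prob [set N : prenet n | eps <= `|X n N - c|] @[n --> \oo] --> (0 : R).

End Laws.

(** * The limit networks *)

(* The graph obtained from a base graph C by decorating the tree vertices in D
   and, recursively, those on the spines so introduced. *)
Section Decorate.
Variables (C : Type) (eC : C -> C -> Prop) (mC : C -> vmark) (D : C -> bool).

(* The decorated vertices: those of the base, and, for x decorated, the
   vertices at the positions i != 0 of the spine through w(x). *)
Inductive decorated : Type :=
  | DBase of {c : C | D c}
  | DSpine of decorated & {i : int | i != 0}.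

Inductive dvert : Type :=
  | VBase of C
  | VSpine of decorated & int (* [VSpine x 0] is w(x) *)
  | VRet of decorated
  | VLeaf of decorated.

Definition dec_vert (x : decorated) : dvert :=
  match x with
  | DBase c => VBase (sval c)
  | DSpine y i => VSpine y (sval i)
  end.

Inductive dedge : dvert -> dvert -> Prop :=
  | EBase c c' : eC c c' -> dedge (VBase c) (VBase c')
  | ESpine x i : dedge (VSpine x i) (VSpine x (i + 1))
  | EDec x : dedge (dec_vert x) (VRet x)
  | EW x : dedge (VSpine x 0) (VRet x)
  | ELeaf x : dedge (VRet x) (VLeaf x).

Definition dmark (v : dvert) : vmark :=
  match v with
  | VBase c => mC c
  | VSpine _ _ => MTree
  | VRet _ => MRet
  | VLeaf _ => MLeaf
  end.

Definition decorate (c : C) : rgraph := @RGraph dvert dedge dmark (VBase c).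

End Decorate.

Definition Lhat : rgraph :=
  decorate (fun i j : int => j = i + 1) (fun _ => MTree) (fun _ => true) 0.

(* [RSpine false i] is p_i and [RSpine true i] is q_i. *)
Inductive rbase : Type := RSpine of bool & int | RRet0 | RLeaf0.

Inductive rbase_edge : rbase -> rbase -> Prop :=
  | RESpine b i : rbase_edge (RSpine b i) (RSpine b (i + 1))
  | RERet b : rbase_edge (RSpine b 0) RRet0
  | RELeaf : rbase_edge RRet0 RLeaf0.

Definition rbase_mark (c : rbase) : vmark :=
  match c with RSpine _ _ => MTree | RRet0 => MRet | RLeaf0 => MLeaf end.

Definition rbase_dec (c : rbase) : bool :=
  if c is RSpine _ i then i != 0 else false.

Definition Rhat : rgraph := decorate rbase_edge rbase_mark rbase_dec RRet0.

Definition Nhat_lf : rgraph := decorate rbase_edge rbase_mark rbase_dec RLeaf0.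

Definition limit_law (R : realType) (E : rgraph -> Prop) : R :=
  2^-1 * `[< E Lhat >]%:R + 4^-1 * `[< E Rhat >]%:R
  + 4^-1 * `[< E Nhat_lf >]%:R.

(* Main.v *)
(* Write k for the number of reticulations and j = n - k.  A network has
   2n + 2k vertices: n leaves, k reticulations, n + k - 1 tree vertices, and only
   2j of them are exceptional (the root, the tree vertices without reticulation
   child, the leaves without reticulation parent).  So it is enough that j and the
   number of vertices close to a short undirected cycle are o(n) on average: the
   ball around any other vertex is a tree with the local structure of the limit.

   Both averages are bounded by a switching.
   - Take a non-reticulate leaf s and a tree vertex b without reticulation child,
     move to s a child of b that is not above s, and let s and b become the parents
     of a new reticulation, above a new leaf that inherits the label of s.  The
     result remembers s and b as the parents of a reticulation, whence
     E[j (j - 1)] <= 2 E[k] <= 2n.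
   - If x lies on a short cycle through its reticulation child, let x exchange
     reticulation children with a remote tree vertex y.  In the result x is still
     close to y, so only boundedly many x are possible for each y, and the mean
     number of such x is O(1 + E[j]).
   Networks have no automorphism, so marked vertices can be carried along when
   networks are counted up to isomorphism. *)

Require Import Defs.
From mathcomp Require Import all_boot all_order all_algebra.
From mathcomp Require Import all_classical all_reals all_analysis.
From mathcomp Require Import perm zify ring lra.

Set Implicit Arguments.
Unset Strict Implicit.
Unset Printing Implicit Defensive.

Import Order.TTheory GRing.Theory Num.Theory.

(** * Structure of a network *)

(** The counting must extract o(n) from a single second-moment bound. The inequality a j <= a (a +
    1) + j (j - 1), with a free integer a, replaces a square root: E[j] / n is of order 1 / a once n
    is large. For cycles, the exchange bounds E[B (2 k - 4 ^ L)], where B counts the vertices x on a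
    short cycle and 4 ^ L the vertices y that are not remote; since B <= 2 n, putting 2 n for 2 k
    costs O(n (1 + E[j])). For the local structure, the infinite tree is mapped to the network from
    its root outwards, bijectively between neighbourhoods. The only global question is injectivity:
    two vertices with the same image give a closed walk without backtracking, hence a cycle, and the
    last vertex of a cycle in a topological order is a reticulation entered from both neighbours.
    This is why it suffices to count cycles that pass from a tree vertex through its reticulation
    child. It is also why the exchange is harmless: it redirects only edges into reticulations,
    below which there is nothing but a leaf. *)

Section Acyclic.
Variables (V : finType) (e : rel V).
Hypothesis ac : acyclic e.

(** The number of descendants, used as a topological numbering that decreases along the edges. *)
Definition rank (x : V) : nat := #|connect e x|.

Lemma rank_lt x y : e x y -> rank y < rank x.
Proof.
move=> exy; apply/proper_card/properP; split.
  by apply/fintype.subsetP => z; apply: connect_trans (connect1 exy).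
by exists x; [exact: connect0 | exact: ac exy].
Qed.

Lemma acyclic_irr x : e x x = false.
Proof. by apply/negP => exx; have := ac exx; rewrite connect0. Qed.

Lemma acyclic_asym x y : e x y -> e y x = false.
Proof. by move=> /ac; apply: contraNF => /connect1. Qed.

(** Climbing to a parent strictly shrinks the set of ancestors, so the climb ends, and it can end
    only at [o]. Reachability in a modified network thus reduces to a check of degrees. *)
Lemma acyclic_reach (o : V) :
  (forall v, v != o -> exists u, e u v) -> forall v, connect e o v.
Proof.
move=> par v; have [m] := ubnP (#|connect e^~ v|).
elim: m v => // m IH v lt_m; have [->|/par[u euv]] := eqVneq v o.
  exact: connect0.
apply: connect_trans (connect1 euv); apply: IH; apply: leq_trans (ltnSE lt_m).
apply/proper_card/properP; split.
  apply/fintype.subsetP => z; rewrite !unfold_in => zu.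
  exact: connect_trans (connect1 euv).
exists v; first by rewrite unfold_in; exact: connect0.
exact: ac euv.
Qed.

End Acyclic.

Section DegreeOne.
Variables (V : finType) (e : rel V).

Lemma indeg1_uniq u u' v : indeg e v = 1 -> e u v -> e u' v -> u = u'.
Proof.
by move=> i1 uv u'v; have /card_le1_eqP := eq_leq i1; apply; rewrite inE.
Qed.

Lemma outdeg1_uniq v w w' : outdeg e v = 1 -> e v w -> e v w' -> w = w'.
Proof.
by move=> i1 uv u'v; have /card_le1_eqP := eq_leq i1; apply; rewrite inE.
Qed.

Lemma indeg_parent v : 0 < indeg e v -> exists u, e u v.
Proof. by case/card_gt0P => u; rewrite inE; exists u. Qed.

Lemma outdeg_child v : 0 < outdeg e v -> exists w, e v w.
Proof. by case/card_gt0P => u; rewrite inE; exists u. Qed.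

Lemma indegE v : indeg e v = \sum_u e u v.
Proof. by rewrite /indeg -sum1_card big_mkcond /=; apply: eq_bigr => u _; rewrite inE; case: e. Qed.

Lemma outdegE v : outdeg e v = \sum_w e v w.
Proof. by rewrite /outdeg -sum1_card big_mkcond /=; apply: eq_bigr => u _; rewrite inE; case: e. Qed.

Lemma sum_pred (P : pred V) : \sum_v (P v : nat) = #|P|.
Proof. by rewrite -sum1_card [RHS]big_mkcond; apply: eq_bigr => v _; rewrite unfold_in; case: (P v). Qed.

End DegreeOne.

Section Network.
Variables (n : nat) (V : finType) (e : rel V) (o : V) (lab : 'I_n -> V).
Hypothesis N : simplex_tree_child e o lab.

Let ac : acyclic e := stc_acyclic N.

Local Notation tree := (is_tree e).
Local Notation ret := (is_ret e).
Local Notation leaf := (is_leaf lab).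

Lemma leaf_deg v : leaf v -> (indeg e v = 1) * (outdeg e v = 0).
Proof. by move/(stc_leaf_deg N)/andP => [/eqP -> /eqP ->]. Qed.

Lemma tree_deg v : tree v -> (indeg e v = 1) * (outdeg e v = 2).
Proof. by move/andP => [/eqP -> /eqP ->]. Qed.

Lemma ret_deg v : ret v -> (indeg e v = 2) * (outdeg e v = 1).
Proof. by move/andP => [/eqP -> /eqP ->]. Qed.

Lemma root_deg : (indeg e o = 0) * (outdeg e o = 1).
Proof. by have /andP[/eqP -> /eqP ->] := stc_root_deg N. Qed.

Lemma edge_outdeg v w : e v w -> 0 < outdeg e v.
Proof. by move=> evw; apply/card_gt0P; exists w; rewrite inE. Qed.

Lemma edge_indeg v w : e v w -> 0 < indeg e w.
Proof. by move=> evw; apply/card_gt0P; exists v; rewrite inE. Qed.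

Lemma edge_nleaf v w : e v w -> ~~ leaf v.
Proof. by move/edge_outdeg => d; apply/negP => /leaf_deg d'; rewrite d' in d. Qed.

Lemma edge_nroot v w : e v w -> w != o.
Proof. by move/edge_indeg => d; apply/eqP => E; rewrite E root_deg in d. Qed.

Lemma ret_nleaf v : ret v -> ~~ leaf v.
Proof. by move=> rv; apply/negP => /leaf_deg; rewrite (ret_deg rv) => -[]. Qed.

Lemma ret_ntree v : ret v -> ~~ tree v.
Proof. by move=> rv; apply/negP => /tree_deg; rewrite (ret_deg rv) => -[]. Qed.

Lemma tree_nleaf v : tree v -> ~~ leaf v.
Proof. by move=> rv; apply/negP => /leaf_deg; rewrite !(tree_deg rv) => -[_]. Qed.

Lemma tree_nroot v : tree v -> v != o.
Proof. by move=> rv; apply/eqP => E; move: rv; rewrite E => /tree_deg; rewrite root_deg => -[]. Qed.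

Lemma ret_nroot v : ret v -> v != o.
Proof. by move=> rv; apply/eqP => E; move: rv; rewrite E => /ret_deg; rewrite root_deg => -[]. Qed.

Lemma leaf_nroot v : leaf v -> v != o.
Proof. by move=> rv; apply/eqP => E; move: rv; rewrite E => /leaf_deg; rewrite root_deg => -[]. Qed.

Lemma root_reach v : v != o -> exists u, e u v.
Proof.
move=> vo; apply: indeg_parent; have [/leaf_deg ->//|nl] := boolP (leaf v).
by have /orP[/tree_deg ->|/ret_deg ->] := stc_inner_deg N vo nl.
Qed.

Lemma nret_indeg1 v : v != o -> ~~ ret v -> indeg e v = 1.
Proof.
move=> vo nr; have [/leaf_deg ->//|nl] := boolP (leaf v).
by have := stc_inner_deg N vo nl; rewrite (negbTE nr) orbF => /tree_deg ->.
Qed.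

(** The only child of the root is a tree vertex or a leaf by the tree-child condition, and the only
    child of a reticulation is a leaf. *)
Lemma ret_parent_tree u w : e u w -> ret w -> tree u.
Proof.
move=> euw rw; have nl := edge_nleaf euw.
have [uo|uo] := eqVneq u o.
  have [w' ew' tw'] := stc_tree_child N nl.
  rewrite uo in euw ew'; have := outdeg1_uniq (root_deg.2) euw ew' => E.
  by move: tw'; rewrite -E (negbTE (ret_ntree rw)) (negbTE (ret_nleaf rw)).
have /orP[//|ru] := stc_inner_deg N uo nl.
by have := ret_nleaf rw; rewrite (stc_one_component N ru euw).
Qed.

Lemma card_gt2_contra (A : pred V) x y z :
  #|A| = 2 -> A x -> A y -> A z -> x != y -> y != z -> z != x -> False.
Proof.
move=> c Ax Ay Az xy yz zx; have : 2 < #|A| by apply/card_gt2P; exists x, y, z.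
by rewrite c.
Qed.

Lemma ret_child_uniq u w w' : e u w -> e u w' -> ret w -> ret w' -> w = w'.
Proof.
move=> euw euw' rw rw'; apply/eqP/negP => /negP ww'.
have tu := ret_parent_tree euw rw.
have [x eux tx] := stc_tree_child N (tree_nleaf tu).
have nr z : ret z -> z != x.
  move=> rz; apply: contraTneq tx => <-.
  by rewrite negb_or ret_ntree ?ret_nleaf.
apply: (@card_gt2_contra (e u) w w' x) => //; first exact: (tree_deg tu).2.
  exact: nr.
by rewrite eq_sym; exact: nr.
Qed.

Definition decorated_tree v := tree v && [exists w, e v w && ret w].
Definition branching v := tree v && ~~ [exists w, e v w && ret w].
Definition bare_leaf v := leaf v && ~~ [exists u, e u v && ret u].
Definition exceptional v := [|| v == o, branching v | bare_leaf v].

Definition nret : nat := #|ret|.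

Lemma card_leaf : #|leaf| = n.
Proof.
rewrite -[RHS]card_ord -(card_codom (stc_lab_inj N)).
exact: eq_card.
Qed.

Lemma vertex_types v :
  ((v == o) + leaf v + tree v + ret v = 1)%N.
Proof.
have [->|vo] := eqVneq v o.
  have := root_deg; rewrite /is_tree /is_ret /has_deg => -[-> ->].
  by rewrite (negbTE (contraTN (@leaf_nroot o) _)) ?eqxx.
have [lv|nl] := boolP (leaf v).
  by rewrite /is_tree /is_ret /has_deg !(leaf_deg lv).
have /orP[tv|rv] := stc_inner_deg N vo nl.
  by rewrite tv; case rv: (ret v) => //; have := ret_ntree rv; rewrite tv.
by rewrite rv (negbTE (ret_ntree rv)).
Qed.

Lemma card_types : #|V| = (1 + n + #|tree| + nret)%N.
Proof.
have -> : 1 = \sum_v (v == o) :> nat.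
  by rewrite (bigD1 o) //= eqxx big1 ?addn0 // => v /negbTE ->.
rewrite -card_leaf /nret -!sum_pred -!big_split /=.
by apply: eq_bigr => v _; rewrite vertex_types.
Qed.

(** Edges counted by their heads and by their tails: [n + t + 2 k = 1 + 2 t + k] for t tree vertices
    and k reticulations. *)
Lemma card_tree : #|tree|.+1 = (n + nret)%N.
Proof.
have := sum_indeg_outdeg e.
rewrite (eq_bigr (fun v => leaf v + tree v + 2 * ret v)%N); last first.
  move=> v _; have := vertex_types v.
  have [->|vo] := eqVneq v o.
    by rewrite root_deg; case: leaf; case: tree; case: ret.
  have [lv|nl] := boolP (leaf v).
    by rewrite (leaf_deg lv); case: tree; case: ret.
  have /orP[tv|rv] := stc_inner_deg N vo nl.
    by rewrite (tree_deg tv) tv; case: ret.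
  by rewrite (ret_deg rv) rv; case: tree.
rewrite [RHS](eq_bigr (fun v => (v == o) + 2 * tree v + ret v)%N); last first.
  move=> v _; have := vertex_types v.
  have [->|vo] := eqVneq v o.
    by rewrite root_deg; case: leaf; case: tree; case: ret.
  have [lv|nl] := boolP (leaf v).
    by rewrite (leaf_deg lv); case: tree; case: ret.
  have /orP[tv|rv] := stc_inner_deg N vo nl.
    by rewrite (tree_deg tv) tv; case: ret.
  by rewrite (ret_deg rv) rv; case: tree.
have -> : \sum_v ((v == o) + 2 * tree v + ret v)%N = (1 + 2 * #|tree| + nret)%N.
  have -> : 1 = \sum_v (v == o) :> nat.
    by rewrite (bigD1 o) //= eqxx big1 ?addn0 // => v /negbTE ->.
  by rewrite /nret -!sum_pred big_distrr -!big_split.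
have -> : \sum_v (leaf v + tree v + 2 * ret v)%N = (n + #|tree| + 2 * nret)%N.
  by rewrite -[X in (X + _ + _)%N]card_leaf /nret -!sum_pred big_distrr -!big_split.
lia.
Qed.

Lemma card_vert : #|V| = (2 * n + 2 * nret)%N.
Proof. by have := card_types; have := card_tree; lia. Qed.

Lemma ret_children u : \sum_(w | ret w) e u w = decorated_tree u.
Proof.
rewrite /decorated_tree.
case: (boolP [exists w, e u w && ret w]) => [/existsP[w /andP[euw rw]]|].
  rewrite (ret_parent_tree euw rw) (bigD1 w) //= euw big1 // => w' /andP[rw' ww'].
  case euw': (e u w') => //.
  by rewrite (ret_child_uniq euw euw' rw rw') eqxx in ww'.
rewrite negb_exists andbF => /forallP H; rewrite big1 // => w rw.
by have := H w; rewrite rw andbT; case: e.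
Qed.

(** Edges into reticulations, counted from both ends: two at each reticulation, one at each
    decorated vertex. *)
Lemma card_decorated : #|decorated_tree| = (2 * nret)%N.
Proof.
rewrite -sum_pred -(eq_bigr _ (fun u _ => ret_children u)).
rewrite exchange_big /= (eq_bigr (fun _ => 2)); last first.
  by move=> w rw; rewrite -indegE (ret_deg rw).
by rewrite sum_nat_const mulnC.
Qed.

Lemma decoratedP u : reflect (exists2 w, e u w & ret w) (decorated_tree u).
Proof.
apply: (iffP andP) => [[_ /existsP[w /andP[]]]|[w euw rw]]; first by exists w.
by split; [exact: ret_parent_tree rw|apply/existsP; exists w; rewrite euw].
Qed.

Lemma card_ret_leaf : (#|bare_leaf| + nret)%N = n.
Proof.
have -> : nret = \sum_w \sum_(u | ret u) e u w.
  rewrite exchange_big /= (eq_bigr (fun _ => 1)); last first.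
    by move=> w rw; rewrite -outdegE (ret_deg rw).
  by rewrite sum_nat_const muln1.
rewrite -[RHS]card_leaf -!sum_pred -big_split /=; apply: eq_bigr => w _.
rewrite /bare_leaf.
case: (boolP [exists u, e u w && ret u]) => [/existsP[u /andP[euw ru]]|].
  rewrite andbF (stc_one_component N ru euw) (bigD1 u) //= euw big1 //.
  move=> u' /andP[ru' uu']; case eu'w: (e u' w) => //.
  have := (leaf_deg (stc_one_component N ru euw)).1 => i1.
  by rewrite (indeg1_uniq i1 euw eu'w) eqxx in uu'.
rewrite negb_exists andbT => /forallP H; rewrite big1 ?addn0 // => u ru.
by have := H u; rewrite ru andbT; case: e.
Qed.

Lemma card_branching : (#|branching| + nret).+1 = n.
Proof.
have : (#|branching| + #|decorated_tree| = #|tree|)%N.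
  rewrite -!sum_pred -big_split /=; apply: eq_bigr => v _.
  by rewrite /branching /decorated_tree; case: tree => //; case: [exists _, _].
by rewrite card_decorated; have := card_tree; lia.
Qed.

Lemma card_exceptional : #|exceptional| = (2 * (n - nret))%N.
Proof.
have -> : #|exceptional| = (1 + #|branching| + #|bare_leaf|)%N.
  have -> : 1 = \sum_v (v == o) :> nat.
    by rewrite (bigD1 o) //= eqxx big1 ?addn0 // => v /negbTE ->.
  rewrite -!sum_pred -!big_split /=; apply: eq_bigr => v _.
  have := vertex_types v; rewrite /exceptional /branching /bare_leaf.
  by case: (v == o); case: leaf; case: tree; case: ret => //=; case: [exists _, _].
by have := card_ret_leaf; have := card_branching; lia.
Qed.

Lemma deg_le3 v : (indeg e v + outdeg e v <= 3)%N.
Proof.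
have [->|vo] := eqVneq v o; first by rewrite !root_deg.
have [lv|nl] := boolP (leaf v); first by rewrite !(leaf_deg lv).
by have /orP[tv|rv] := stc_inner_deg N vo nl; rewrite ?(tree_deg tv) ?(ret_deg rv).
Qed.

(* Every vertex has a child with no other parent, so that fixing the leaves
   fixes every vertex. *)
Lemma network_rigid (f : V -> V) :
  (forall i, f (lab i) = lab i) -> (forall x y, e (f x) (f y) = e x y) ->
  forall x, f x = x.
Proof.
move=> fl fe x; have [m] := ubnP (rank e x); elim: m x => // m IH x lt_m.
have [/codomP[i ->] //|nl] := boolP (leaf x).
have [w exw tw] := stc_tree_child N nl.
have fw : f w = w by apply: IH; exact: leq_trans (rank_lt ac exw) (ltnSE lt_m).
have i1 : indeg e w = 1 by case/orP: tw => [/tree_deg|/leaf_deg] ->.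
by apply: (indeg1_uniq i1 _ exw); rewrite -fw fe.
Qed.

End Network.

(** * Switchings of marked networks *)

Section Connect.
Variables (T : finType) (e : rel T).

Lemma connect_ind_l (P : T -> Prop) y :
  P y -> (forall x z, e x z -> connect e z y -> P z -> P x) ->
  forall x, connect e x y -> P x.
Proof.
move=> Py step x /connectP[p]; elim: p x => [|z p IH] x /= => [_ <-//|].
move=> /andP[exz pz] yl; apply: (step _ z) => //; last exact: IH.
by apply/connectP; exists p.
Qed.

Lemma connect_ind_r (P : T -> Prop) x :
  P x -> (forall z y, connect e x z -> e z y -> P z -> P y) ->
  forall y, connect e x y -> P y.
Proof.
move=> Px step y /connectP[p]; elim/last_ind: p y => [|p z IH] y /=.
  by move=> _ ->.
rewrite rcons_path last_rcons => /andP[pp elz] ->.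
apply: (step (last x p)) => //; last exact: IH.
by apply/connectP; exists p.
Qed.

Lemma connect_step x y : connect e x y -> x != y -> exists2 z, connect e x z & e z y.
Proof.
move=> cxy; move: y cxy; apply: connect_ind_r; first by rewrite eqxx.
by move=> z y cxz ezy _ _; exists z.
Qed.

End Connect.

(** The vertex type is arbitrary because a switching may build its result on another type, such as
    [V + bool]; [networks_rep] leads back to representatives. The marks are the two vertices at
    which the switching acts. *)
Record marked_net (n : nat) := MarkedNet {
  mvert : finType;
  medge : rel mvert;
  mroot : mvert;
  mlab : 'I_n -> mvert;
  mark1 : mvert;
  mark2 : mvert
}.

Definition mnetwork n (M : marked_net n) : Prop :=
  simplex_tree_child (@medge n M) (mroot M) (@mlab n M).

Definition marked_rep n (N : prenet n) (x y : nvert N) : marked_net n :=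
  MarkedNet (@nedge n N) (nroot N) (@nlab n N) x y.

Definition is_iso n (M M' : marked_net n) (f : mvert M -> mvert M') : Prop :=
  [/\ bijective f, f (mroot M) = mroot M', forall i, f (mlab M i) = mlab M' i &
      forall x y, medge (f x) (f y) = medge x y].

Definition marked_iso n (M M' : marked_net n) : Prop :=
  exists2 f : mvert M -> mvert M',
    is_iso f & f (mark1 M) = mark1 M' /\ f (mark2 M) = mark2 M'.

Section Iso.
Variable n : nat.
Implicit Types M : marked_net n.

Lemma is_iso_inv M1 M2 (f : mvert M1 -> mvert M2) g :
  cancel f g -> cancel g f -> is_iso f -> is_iso g.
Proof.
move=> fK gK [_ fr fl fe]; split; first by exists f.
- by rewrite -fr fK.
- by move=> i; rewrite -fl fK.
- by move=> x y; rewrite -{2}(gK x) -{2}(gK y) fe.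
Qed.

Lemma is_iso_comp M1 M2 M3 (f : mvert M1 -> mvert M2) (g : mvert M2 -> mvert M3) :
  is_iso f -> is_iso g -> is_iso (g \o f).
Proof.
move=> [fb fr fl fe] [gb gr gl ge]; split => /=; first exact: bij_comp.
- by rewrite fr.
- by move=> i; rewrite fl.
- by move=> x y; rewrite ge fe.
Qed.

Lemma marked_iso_sym M M' : marked_iso M M' -> marked_iso M' M.
Proof.
move=> [f fi [f1 f2]]; have [[g fK gK] _ _ _] := fi.
by exists g; [exact: is_iso_inv fi | rewrite -f1 -f2 !fK].
Qed.

Lemma marked_iso_trans M1 M2 M3 :
  marked_iso M1 M2 -> marked_iso M2 M3 -> marked_iso M1 M3.
Proof.
move=> [f fi [f1 f2]] [g gi [g1 g2]]; exists (g \o f); first exact: is_iso_comp.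
by rewrite /= f1 f2.
Qed.

Section Transfer.
Variables (M M' : marked_net n) (f : mvert M -> mvert M').
Hypothesis fi : is_iso f.

Lemma is_iso_indeg v : indeg (@medge n M') (f v) = indeg (@medge n M) v.
Proof.
have [fb _ _ fe] := fi.
rewrite !indegE (reindex f) /=; last exact: onW_bij.
by apply: eq_bigr => u _; rewrite fe.
Qed.

Lemma is_iso_outdeg v : outdeg (@medge n M') (f v) = outdeg (@medge n M) v.
Proof.
have [fb _ _ fe] := fi.
rewrite !outdegE (reindex f) /=; last exact: onW_bij.
by apply: eq_bigr => u _; rewrite fe.
Qed.

Lemma is_iso_tree v : is_tree (@medge n M') (f v) = is_tree (@medge n M) v.
Proof. by rewrite /is_tree /has_deg is_iso_indeg is_iso_outdeg. Qed.

Lemma is_iso_ret v : is_ret (@medge n M') (f v) = is_ret (@medge n M) v.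
Proof. by rewrite /is_ret /has_deg is_iso_indeg is_iso_outdeg. Qed.

Lemma is_iso_leaf v : is_leaf (@mlab n M') (f v) = is_leaf (@mlab n M) v.
Proof.
have [fb _ fl _] := fi; apply/codomP/codomP => -[i].
  by rewrite -fl => /(bij_inj fb) ->; exists i.
by move=> ->; exists i.
Qed.

Lemma is_iso_connect x y : connect (@medge n M) x y -> connect (@medge n M') (f x) (f y).
Proof.
have [_ _ _ fe] := fi.
move: x; apply: connect_ind_l => [|x z exz _ cz]; first exact: connect0.
by apply: connect_trans cz; apply: connect1; rewrite fe.
Qed.

End Transfer.

Lemma is_iso_network M M' (f : mvert M -> mvert M') :
  is_iso f -> mnetwork M -> mnetwork M'.
Proof.
move=> fi N; have [[g fK gK] fr fl fe] := fi.
have gi := is_iso_inv fK gK fi; split.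
- move=> x y; rewrite -[x]gK -[y]gK fe => /(stc_acyclic N).
  by apply: contra => /(is_iso_connect gi); rewrite !fK.
- by rewrite -fr /has_deg is_iso_indeg // is_iso_outdeg //; exact: stc_root_deg N.
- move=> v; rewrite -fr -[v]gK; apply: is_iso_connect => //.
  exact: stc_reach N _.
- move=> i j; rewrite -!fl => /(can_inj fK); exact: stc_lab_inj N _ _.
- move=> v; rewrite -[v]gK is_iso_leaf // /has_deg is_iso_indeg // is_iso_outdeg //.
  exact: stc_leaf_deg N _.
- move=> v; rewrite -[v]gK -fr (can_eq fK) is_iso_leaf // is_iso_ret // is_iso_tree //.
  exact: stc_inner_deg N _.
- move=> v; rewrite -[v]gK is_iso_leaf // => /(stc_tree_child N)[w ew tw].
  by exists (f w); rewrite ?fe ?is_iso_tree ?is_iso_leaf.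
- move=> v w; rewrite -[v]gK -[w]gK fe is_iso_ret // is_iso_leaf //.
  exact: stc_one_component N _ _.
Qed.

Lemma network_refl (N : prenet n) : net_iso N N.
Proof. by exists id; split => //; exists id. Qed.

Lemma network_sym (N N' : prenet n) : net_iso N N' -> net_iso N' N.
Proof.
move=> [f [[g fK gK] fr fl fe]]; exists g; split; first by exists f.
- by rewrite -fr fK.
- by move=> i; rewrite -fl fK.
- by move=> x y; rewrite -[x in RHS]gK -[y in RHS]gK fe.
Qed.

Lemma network_trans (N N' N'' : prenet n) :
  net_iso N N' -> net_iso N' N'' -> net_iso N N''.
Proof.
move=> [f [fb fr fl fe]] [g [gb gr gl ge]]; exists (g \o f).
split => /=; first exact: bij_comp.
- by rewrite fr.
- by move=> i; rewrite fl.
- by move=> x y; rewrite ge fe.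
Qed.

Let D := [set N : prenet n | `[< is_network N >]]%SET.
Let iso (N M : prenet n) := `[< net_iso N M >].

Let iso_equiv : {in D & &, equivalence_rel iso}.
Proof.
move=> N1 N2 N3 _ _ _; split; first exact/asboolP/network_refl.
move/asboolP => i12; apply/asboolP/asboolP; apply: network_trans => //.
exact: network_sym.
Qed.

Let part := equivalence_partitionP iso_equiv.
Let trans := transversalP part.

Lemma networks_network (N : prenet n) : N \in networks n -> is_network N.
Proof.
by move/(fintype.subsetP (transversal_sub trans)); rewrite inE => /asboolP.
Qed.

Lemma networks_inj (N N' : prenet n) :
  N \in networks n -> N' \in networks n -> net_iso N N' -> N = N'.
Proof.
move=> NX NX' i; have [ND ND'] : N \in D /\ N' \in D.
  by split; apply: (fintype.subsetP (transversal_sub trans)).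
apply: (pblock_inj trans) => //; apply/eqP; rewrite eq_pblock.
- by rewrite pblock_equivalence_partition //; exact/asboolP.
- by case/and3P: part.
- by rewrite (cover_partition part).
Qed.

(** The bound [stc_card_le] lets the vertices be numbered in some ['I_m] with [m <= 4 * n]; the
    numbered copy is then replaced by the representative of its class. *)
Lemma networks_rep M : mnetwork M ->
  exists N : prenet n, exists x y : nvert N,
    [/\ N \in networks n, is_network N & marked_iso M (marked_rep x y)].
Proof.
move=> nM; have lt_m : #|mvert M| < (4 * n).+1 by rewrite ltnS (stc_card_le nM).
pose m := Ordinal lt_m.
pose er (x : mvert M) : 'I_m := enum_rank x.
pose N0 : prenet n := @existT _ (fun m : 'I_(4 * n).+1 =>
    ({set 'I_m * 'I_m} * 'I_m * {ffun 'I_n -> 'I_m})%type) m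
  ([set (er p.1, er p.2) | p : mvert M * mvert M & medge p.1 p.2]%SET,
   er (mroot M), [ffun i => er (mlab M i)]).
have erK : cancel er (@enum_val _ (mvert M)) by exact: enum_rankK.
have fi : @is_iso n M (@marked_rep n N0 (er (mark1 M)) (er (mark2 M))) er.
  split.
  - by exists (@enum_val _ (mvert M)); [exact: enum_rankK|exact: enum_valK].
  - by [].
  - by move=> i; rewrite /= /nlab /= ffunE.
  - move=> x y; rewrite /= /nedge /=; apply/imsetP/idP.
      by move=> [[u v]]; rewrite inE /= => euv [/(can_inj erK) -> /(can_inj erK) ->].
    by move=> exy; exists (x, y); rewrite ?inE.
have nN0 : is_network N0 := is_iso_network fi nM.
have N0D : N0 \in D by rewrite inE; apply/asboolP.
have N0c : N0 \in finset.cover (equivalence_partition iso D) by rewrite (cover_partition part).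
have BP := pblock_mem N0c.
have NX := repr_mem_transversal trans N0 BP.
have := repr_mem_pblock trans N0 BP.
set N := transversal_repr _ _ _ in NX *.
have ND := fintype.subsetP (transversal_sub trans) _ NX.
rewrite pblock_equivalence_partition // => /asboolP[g [gb gr gl ge]].
exists N, (g (er (mark1 M))), (g (er (mark2 M))); split => //.
  exact: networks_network.
apply: (@marked_iso_trans _ (@marked_rep n N0 (er (mark1 M)) (er (mark2 M)))).
  by exists er.
by exists g.
Qed.

(* Representatives have no automorphism, so a marked representative is
   determined by its isomorphism class. *)
Lemma marked_rep_inj (N N' : prenet n) (x y : nvert N) (x' y' : nvert N') :
  N \in networks n -> N' \in networks n ->
  marked_iso (marked_rep x y) (marked_rep x' y') ->
  existT (fun N : prenet n => (nvert N * nvert N)%type) N (x, y) =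
  existT (fun N : prenet n => (nvert N * nvert N)%type) N' (x', y').
Proof.
move=> NX NX' [f [fb fr fl fe] [/= fx fy]].
have E : N = N' by apply: networks_inj => //; exists f.
subst N'; rewrite -fx -fy.
have fid := @network_rigid n _ _ _ _ (networks_network NX) f.
by rewrite !fid.
Qed.

(** This is [#|networks n|] times the expected number of ordered pairs of marks with property
    [P]. *)
Definition count_marks (P : marked_net n -> Prop) : nat :=
  \sum_(N in networks n)
     #|[pred xy : nvert N * nvert N | `[< P (marked_rep xy.1 xy.2) >]]|.

(** Each marked representative is sent to a representative of some result. The source is determined
    up to isomorphism by the result, and by [marked_rep_inj] exactly. [Sw] is a relation, not a
    function, because grafting leaves the choice of a child open. *)
Lemma switching (P Q : marked_net n -> Prop) (Sw : marked_net n -> marked_net n -> Prop) :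
  (forall M, mnetwork M -> P M -> exists M', [/\ mnetwork M', Sw M M' & Q M']) ->
  (forall M M', marked_iso M M' -> Q M -> Q M') ->
  (forall M1 M2 M1' M2', mnetwork M1 -> mnetwork M2 -> Sw M1 M1' -> Sw M2 M2' ->
     marked_iso M1' M2' -> marked_iso M1 M2) ->
  count_marks P <= count_marks Q.
Proof.
move=> Swex Qiso Swinj.
pose T := {N : prenet n & (nvert N * nvert N)%type} : finType.
pose rep (u : T) := marked_rep (tagged u).1 (tagged u).2.
pose A (F : marked_net n -> Prop) := [pred u : T | (tag u \in networks n) && `[< F (rep u) >]].
have cA F : count_marks F = #|A F|.
  rewrite /count_marks -[RHS]sum1_card.
  rewrite (eq_bigr (fun N => \sum_(xy : nvert N * nvert N |
     `[< F (marked_rep xy.1 xy.2) >]) 1)); last first.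
    by move=> N _; rewrite sum1_card.
  by rewrite sig_big_dep.
rewrite !cA.
pose rel u u' := u' \in A Q /\ exists2 M', Sw (rep u) M' & marked_iso M' (rep u').
(* The default [u] is never taken on [A P], where [Swex] and [networks_rep] provide a [u']. *)
pose g (u : T) : T := odflt u [pick u' | `[< rel u u' >]].
have gP u : u \in A P -> rel u (g u).
  rewrite inE => /andP[uX /asboolP Pu]; rewrite /g.
  case: pickP => [u' /asboolP //|no].
  have [M' [nM' sw QM']] := Swex (rep u) (networks_network uX) Pu.
  have [N [x [y [NX _ i]]]] := networks_rep nM'.
  have /asboolP[] := no (existT _ N (x, y)); split; last by exists M'.
  by rewrite inE NX; apply/asboolP; exact: Qiso QM'.
rewrite -(@card_in_image _ _ g (A P)).
  apply: subset_leq_card; apply/fintype.subsetP => _ /fintype.imageP[u uA ->].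
  exact: (gP u uA).1.
move=> u1 u2 u1A u2A gE.
have [_ [M1 sw1 i1]] := gP _ u1A; have [_ [M2 sw2 i2]] := gP _ u2A.
rewrite gE in i1; have i12 := marked_iso_trans i1 (marked_iso_sym i2).
move: u1A u2A; rewrite !inE => /andP[X1 _] /andP[X2 _].
have := Swinj (rep u1) (rep u2) _ _ (networks_network X1) (networks_network X2) sw1 sw2 i12.
move/(marked_rep_inj X1 X2); case: u1 {gE sw1 i1 X1} => N1 [x1 y1].
by case: u2 {sw2 i2 X2} => N2 [x2 y2].
Qed.

End Iso.

(** * Exchanging two reticulation children *)

Section Near.
Variables (V : finType) (e : rel V).

Definition adj : rel V := fun x y => e x y || e y x.

Lemma adj_irr : acyclic e -> forall x, adj x x = false.
Proof. by move=> ac x; rewrite /adj orbb (acyclic_irr ac). Qed.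

Fixpoint nearby (r : nat) (x y : V) : bool :=
  if r is r'.+1 then (x == y) || [exists z, adj x z && nearby r' z y] else x == y.

Lemma adj_sym : symmetric adj.
Proof. by move=> x y; rewrite /adj orbC. Qed.

Lemma nearby_refl r x : nearby r x x.
Proof. by case: r => [|r] /=; rewrite eqxx. Qed.

Lemma nearby_le r s x y : r <= s -> nearby r x y -> nearby s x y.
Proof.
move=> /subnK <-; elim: (s - r)%N => // m IH /IH.
rewrite addSn; move: (m + r)%N => k {IH}.
elim: k x => [|k IH] x; first by move/eqP->; exact: nearby_refl.
case/orP => [/eqP->|/existsP[z /andP[xz zy]]]; first exact: nearby_refl.
by apply/orP; right; apply/existsP; exists z; rewrite xz; exact: IH.
Qed.

Lemma nearby_trans r s x y z : nearby r x y -> nearby s y z -> nearby (r + s) x z.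
Proof.
elim: r x => [|r IH] x; first by move/eqP->.
case/orP => [/eqP->|/existsP[u /andP[xu uy]]] yz.
  by apply: nearby_le yz; rewrite leq_addl.
by apply/orP; right; apply/existsP; exists u; rewrite xu; exact: IH.
Qed.

Lemma nearby_adj x y : adj x y -> nearby 1 x y.
Proof. by move=> xy; apply/orP; right; apply/existsP; exists y; rewrite xy /=. Qed.

Lemma nearby_sym r x y : nearby r x y = nearby r y x.
Proof.
suff H u v : nearby r u v -> nearby r v u by apply/idP/idP; exact: H.
elim: r u => [|r IH] u /=; first by rewrite eq_sym.
case/orP => [/eqP->|/existsP[z /andP[uz zv]]]; first by rewrite eqxx.
rewrite -/(nearby r.+1 v u) -addn1; apply: nearby_trans (IH _ zv) _.
by apply: nearby_adj; rewrite adj_sym.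
Qed.

Lemma nearby_path x p y : path adj x p -> y \in x :: p -> nearby (size p) x y.
Proof.
elim: p x => [|z p IH] x /=; first by rewrite inE eq_sym.
case/andP => xz pz; rewrite inE => /orP[/eqP->|yp]; first by rewrite eqxx.
by apply/orP; right; apply/existsP; exists z; rewrite xz; exact: IH.
Qed.

(** Induction with at most three neighbours at each vertex: [1 + 3 * 4 ^ r <= 4 ^ r.+1]. *)
Lemma card_nearby r x : (forall v, (indeg e v + outdeg e v <= 3)%N) ->
  #|nearby r x| <= 4 ^ r.
Proof.
move=> deg; elim: r x => [|r IH] x; first by rewrite (@fintype.eq_card1 _ x) // => y; rewrite inE eq_sym.
rewrite -sum_pred.
have le : \sum_v nearby r.+1 x v <= \sum_v ((v == x) + \sum_(z | adj x z) nearby r z v)%N.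
  apply: leq_sum => v _ /=; have [->|vx] := eqVneq v x; first by rewrite /= leq_addr.
  case: existsP => //= -[z /andP[xz zv]].
  by rewrite (bigD1 z) //= zv.
apply: leq_trans le _; rewrite big_split /= exchange_big /=.
rewrite (bigD1 x) //= eqxx big1 ?addn0; last by move=> v /negbTE->.
have le3 : \sum_(z | adj x z) \sum_v nearby r z v <= 3 * 4 ^ r.
  apply: (@leq_trans (\sum_(z | adj x z) 4 ^ r)%N).
    by apply: leq_sum => z _; rewrite sum_pred.
  rewrite sum_nat_const leq_mul2r; apply/orP; right.
  apply: leq_trans (deg x); rewrite indegE outdegE -big_split -sum_pred /=.
  by apply: leq_sum => z _; rewrite /adj; case: (e x z); case: (e z x).
have : 0 < 4 ^ r by rewrite expn_gt0.
by rewrite expnS; move: le3; lia.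
Qed.

(** The cycle is [x -> w <- a], closed by an undirected walk from [a] to [x] that avoids the
    reticulation [w]. The other parent [a] is an argument because it is the vertex that keeps its
    edge to [w] in the exchange, and remoteness is measured from it. *)
Definition on_short_cycle (L : nat) (x : V) (a : V) : Prop :=
  exists w p, [/\ is_ret e w, e x w, e a w & a != x] /\
    [/\ path adj a p, last a p = x, size p <= L & w \notin p].

Definition short_cycle (L : nat) (x : V) : Prop := exists a, on_short_cycle L x a.

End Near.

Lemma nearby_iso n (M M' : marked_net n) (f : mvert M -> mvert M') r x y :
  is_iso f -> nearby (@medge n M) r x y -> nearby (@medge n M') r (f x) (f y).
Proof.
move=> fi; have [_ _ _ fe] := fi; elim: r x => [|r IH] x /=; first by move/eqP->.
case/orP => [/eqP->|/existsP[z /andP[xz zy]]]; first by rewrite eqxx.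
by apply/orP; right; apply/existsP; exists (f z); rewrite /adj !fe; apply/andP; split; last exact: IH.
Qed.

Section Swap.
Variables (n : nat) (V : finType) (e : rel V) (o : V) (lab : 'I_n -> V).
Hypothesis N : simplex_tree_child e o lab.
Variables x y : V.

(** The tails [x] and [y] are transposed on edges into reticulations and nowhere else. This makes
    the operation an involution and leaves indegrees visibly unchanged. *)
Definition swap_edge : rel V :=
  fun u w => e (if is_ret e w then tperm x y u else u) w.

Hypothesis dx : decorated_tree e x.
Hypothesis dy : decorated_tree e y.

Lemma swap_indeg w : indeg swap_edge w = indeg e w.
Proof.
rewrite !indegE /swap_edge; case: (is_ret e w) => //.
by rewrite [RHS](reindex_inj (@perm_inj _ (tperm x y))).
Qed.

Lemma swap_outdeg u : outdeg swap_edge u = outdeg e u.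
Proof.
rewrite !outdegE (bigID (is_ret e)) [RHS](bigID (is_ret e)) /=; congr addn.
  rewrite (eq_bigr (fun w => e (tperm x y u) w : nat)); last first.
    by move=> w rw; rewrite /swap_edge rw.
  rewrite !(ret_children N); congr (nat_of_bool _).
  by case: tpermP => [->|->|//]; rewrite dx dy.
by apply: eq_bigr => w nr; rewrite /swap_edge (negbTE nr).
Qed.

Lemma swap_ret : is_ret swap_edge =1 is_ret e.
Proof. by move=> v; rewrite /is_ret /has_deg swap_indeg swap_outdeg. Qed.

Lemma swap_tree : is_tree swap_edge =1 is_tree e.
Proof. by move=> v; rewrite /is_tree /has_deg swap_indeg swap_outdeg. Qed.

Lemma swap_ret_edge v w : is_ret e v -> swap_edge v w = e v w.
Proof.
move=> rv; rewrite /swap_edge; case: ifP => // rw; congr (e _ w).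
have nt z : decorated_tree e z -> z != v.
  by case/andP => tz _; apply: contraTneq tz => ->; exact: ret_ntree.
by rewrite tpermD // nt.
Qed.

Lemma swap_network : simplex_tree_child swap_edge o lab.
Proof.
have ac : acyclic swap_edge.
  (* A path to a vertex that is neither a reticulation nor a leaf meets no reticulation, since only
     a leaf lies below one. Hence none of its edges was redirected. *)
  have back v u : connect swap_edge v u -> ~~ is_ret e u -> ~~ is_leaf lab u ->
      connect e v u && ~~ is_ret e v.
    move=> + nr nl; move: v; apply: connect_ind_l; first by rewrite connect0 nr.
    move=> v w vw cwu /andP[cw rw].
    move: (vw); rewrite /swap_edge (negbTE rw) => evw.
    rewrite (connect_trans (connect1 evw) cw) /=; apply/negP => rv.
    have lw := stc_one_component N rv evw.
    case/connectP: cw => -[|z p] /=; first by move=> _ E; rewrite E lw in nl.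
    by case/andP => /(edge_nleaf N); rewrite lw.
  move=> u v uv; apply/negP => cvu.
  have nl : ~~ is_leaf lab u.
    apply/negP => /(leaf_deg N)[_ o0].
    by have := edge_outdeg uv; rewrite swap_outdeg o0.
  have [ru|nr] := boolP (is_ret e u).
    have euv : e u v by rewrite -swap_ret_edge.
    have lv := stc_one_component N ru euv.
    case/connectP: cvu => -[|z p] /=; first by move=> _ E; rewrite E lv in nl.
    by case/andP => /edge_outdeg; rewrite swap_outdeg (leaf_deg N lv).
  have /andP[cvu' nrv] := back _ _ cvu nr nl.
  by move: uv; rewrite /swap_edge (negbTE nrv) => /(stc_acyclic N); rewrite cvu'.
split => //.
- by rewrite /has_deg swap_indeg swap_outdeg; exact: stc_root_deg N.
- apply: acyclic_reach => // v /(root_reach N)[u /edge_indeg].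
  by rewrite -swap_indeg => /indeg_parent.
- exact: stc_lab_inj N.
- move=> v; rewrite /has_deg swap_indeg swap_outdeg; exact: stc_leaf_deg N _.
- move=> v; rewrite swap_ret swap_tree; exact: stc_inner_deg N _.
- move=> v /(stc_tree_child N)[w vw tw]; exists w; last by rewrite swap_tree.
  have nr : ~~ is_ret e w.
    by apply/negP => rw; move: tw; rewrite (negbTE (ret_ntree rw)) (negbTE (ret_nleaf N rw)).
  by rewrite /swap_edge (negbTE nr).
- by move=> v w; rewrite swap_ret => rv; rewrite swap_ret_edge //; exact: stc_one_component N _ _ rv.
Qed.

(** After the exchange [w] is a child of [y] and still of [a]: two steps from [y] to [a]. The walk
    from [a] to [x] survives, because an edge of it could change only by entering [w] or by leaving
    [y], and [y] is too far from [a] to be on it. *)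
Lemma swap_nearby L a : on_short_cycle e L x a -> ~~ nearby e L a y -> nearby swap_edge (L + 2) y x.
Proof.
move=> [w [p [[rw exw eaw ax] [pp lp sp wp]]]] nay.
have ay : a != y by apply: contraNneq nay => ->; exact: nearby_refl.
have e1 : adj swap_edge y w by rewrite /adj /swap_edge rw tpermR exw.
have e2 : adj swap_edge w a.
  by rewrite adj_sym /adj /swap_edge rw tpermD ?eaw // eq_sym.
have pp' : path (adj swap_edge) a p.
  pose P z := (z != w) && (z != y).
  apply: (@sub_in_path _ P (adj e)) (pp).
    have sub u v : P u -> P v -> e u v -> swap_edge u v.
      move=> /andP[uw uy] /andP[vw vy] euv; rewrite /swap_edge.
      case: ifP => // rv; case: tpermP => [E|E|//]; last by rewrite E eqxx in uy.
      rewrite E in euv.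
      by rewrite (ret_child_uniq N euv exw rv rw) eqxx in vw.
    by move=> u v Pu Pv /orP[] ?; apply/orP; [left|right]; exact: sub.
  apply/allP => z zp; apply/andP; split.
    move: zp; rewrite inE => /orP[/eqP->|zp]; last by apply: contraNneq wp => <-.
    by apply: contraTneq eaw => ->; rewrite (acyclic_irr (stc_acyclic N)).
  by apply: contraNneq nay => <-; apply: nearby_le sp (nearby_path pp zp).
rewrite addnC -[2]/(1 + 1)%N; apply: nearby_trans (nearby_trans (nearby_adj e1) (nearby_adj e2)) _.
by apply: nearby_le sp _; apply: nearby_path; rewrite // -lp mem_last.
Qed.

End Swap.

Lemma swap_edgeK (V : finType) (e : rel V) x y u w :
  swap_edge e x y (if is_ret e w then tperm x y u else u) w = e u w.
Proof. by rewrite /swap_edge; case: (is_ret e w) => //; rewrite tpermK. Qed.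

Definition swapped n (M : marked_net n) : marked_net n :=
  MarkedNet (swap_edge (@medge n M) (mark1 M) (mark2 M)) (mroot M) (@mlab n M)
    (mark1 M) (mark2 M).

(** The result keeps the marks [x] and [y], so a second exchange recovers the source; an isomorphism
    that respects the marks commutes with the transposition. *)
Lemma swap_count n L :
  count_marks (fun M : marked_net n => exists2 a,
      on_short_cycle (@medge n M) L (mark1 M) a &
      decorated_tree (@medge n M) (mark2 M) /\ ~~ nearby (@medge n M) L a (mark2 M))
  <= count_marks (fun M : marked_net n => nearby (@medge n M) (L + 2) (mark2 M) (mark1 M)).
Proof.
pose D (M : marked_net n) := decorated_tree (@medge n M) (mark1 M) /\ decorated_tree (@medge n M) (mark2 M).
apply: (switching (Sw := fun M M' => D M /\ M' = swapped M)).
- move=> M nM [a ca [dy nay]]; exists (swapped M).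
  have dx : decorated_tree (@medge n M) (mark1 M).
    by case: ca => w [p [[rw ? _ _] _]]; apply/(decoratedP nM); exists w.
  split; first exact: swap_network.
    by split.
  have := swap_nearby nM ca nay; exact id.
- by move=> M M' [f fi [<- <-]]; exact: nearby_iso.
move=> M1 M2 _ _ N1 N2 [[dx1 dy1] ->] [[dx2 dy2] ->] [f fi [/= fx fy]].
exists f => //; have [fb fr fl fe] := fi; split => // u w.
rewrite -(swap_edgeK _ (mark1 M1) (mark2 M1)) -(swap_edgeK _ (mark1 M2) (mark2 M2)).
rewrite -[RHS]fe /=.
have -> : is_ret (@medge n M2) (f w) = is_ret (@medge n M1) w.
  rewrite -(swap_ret N1 dx1 dy1) -(swap_ret N2 dx2 dy2).
  exact: (@is_iso_ret n (swapped M1) (swapped M2) f).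
congr (swap_edge _ _ _ _ _); case: ifP => // _.
by rewrite (inj_tperm _ _ _ (bij_inj fb)) fx fy.
Qed.

(** * Grafting a branch on a leaf *)

Section Graft.
Variables (n : nat) (V : finType) (e : rel V) (o : V) (lab : 'I_n -> V).
Hypothesis N : simplex_tree_child e o lab.
Variables s b : V.
Hypothesis bs : bare_leaf e lab s.
Hypothesis bb : branching e b.

Let ac : acyclic e := stc_acyclic N.

Lemma branching_child_nret c : e b c -> ~~ is_ret e c.
Proof.
move=> ebc; apply/negP => rc; case/andP: bb => _ /existsP[].
by exists c; rewrite ebc.
Qed.

Lemma branching_child_indeg c : e b c -> indeg e c = 1.
Proof.
by move=> ebc; exact: (nret_indeg1 N (edge_nroot N ebc) (branching_child_nret ebc)).
Qed.

(* The ancestors of a leaf that is not below a reticulation form a chain. *)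
Lemma graft_child : exists2 c, e b c & ~~ connect e c s.
Proof.
case/andP: (bb) => tb _.
have /card_gt1P[c1 [c2 []]] : 1 < outdeg e b by rewrite (tree_deg tb).
rewrite !inE => b1 b2 c12.
have [c1s|] := boolP (connect e c1 s); last by exists c1.
exists c2 => //; apply/negP => c2s.
(* This property passes from [s] up to its ancestors: a vertex with it has a unique parent, and that
   parent, not being a leaf, is not below a reticulation. A common descendant of [c1] and [c2] can
   thus be lifted until it is one of them, and then its parent [b] closes a directed cycle. *)
pose ok t := ~~ is_ret e t /\ forall u, e u t -> ~~ is_ret e u.
have oks : ok s.
  case/andP: bs => ls /existsPn nu; split.
    by apply: contraL ls; exact: (ret_nleaf N).
  by move=> u eus; have := nu u; rewrite eus.
suff H t : connect e c1 t -> connect e c2 t -> ok t -> False by exact: (H s).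
move: t; apply: connect_ind_r => [c21 _|z y c1z ezy IH c2y oky].
  rewrite eq_sym in c12; have [z c2z ez1] := connect_step c21 c12.
  have E := indeg1_uniq (branching_child_indeg b1) ez1 b1.
  by have := ac b2; rewrite -E c2z.
have [E|c2ny] := eqVneq c2 y.
  rewrite -E in ezy.
  have E' := indeg1_uniq (branching_child_indeg b2) ezy b2.
  by have := ac b1; rewrite -E' c1z.
have [z' c2z' ez'y] := connect_step c2y c2ny.
have i1 : indeg e y = 1 by apply: (nret_indeg1 N) oky.1; exact: (edge_nroot N ezy).
apply: IH; first by rewrite (indeg1_uniq i1 ezy ez'y).
split; first exact: oky.2.
move=> u euz; apply/negP => ru.
by have := edge_nleaf N ezy; rewrite (stc_one_component N ru euz).
Qed.

Variable c : V.
Hypothesis ebc : e b c.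
Hypothesis ncs : ~~ connect e c s.

(** The only edge into [c] comes from [b], and the leaf [s] has no outgoing edge, so the
    transposition just makes [s] the parent of [c] instead of [b]. Written as a permutation of tails
    it preserves indegrees at once. *)
Definition move_edge : rel V :=
  fun x y => e (if y == c then tperm s b x else x) y.

(* [inr false] is the new reticulation and [inr true] the new leaf. *)
Definition graft_edge : rel (V + bool) := fun u w =>
  match u, w with
  | inl x, inl y => move_edge x y
  | inl x, inr false => (x == s) || (x == b)
  | inr false, inr true => true
  | _, _ => false
  end.

Definition graft_lab (i : 'I_n) : V + bool :=
  if lab i == s then inr true else inl (lab i).

Let ls : is_leaf lab s. Proof. by case/andP: bs. Qed.
Let tb : is_tree e b. Proof. by case/andP: bb. Qed.

Let sb : s != b.
Proof. by apply: contraTneq tb => <-; apply: contraL ls; exact: (tree_nleaf N). Qed.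

Let es y : e s y = false.
Proof. by apply/negP => /(edge_nleaf N); rewrite ls. Qed.

Lemma move_edge_c x : move_edge x c = (x == s).
Proof.
rewrite /move_edge eqxx; apply/idP/eqP => [ec|->]; last by rewrite tpermL.
have := indeg1_uniq (branching_child_indeg ebc) ec ebc.
by rewrite -[in RHS](tpermL s b) => /perm_inj.
Qed.

Lemma move_edge_neq x y : y != c -> move_edge x y = e x y.
Proof. by rewrite /move_edge => /negbTE->. Qed.

(** The new edge from [s] to [c] is used at most once by a path, as [c] is not above [s]. *)
Lemma move_connect x y : connect move_edge x y ->
  connect e x y \/ connect e x s /\ connect e c y.
Proof.
move: x; apply: connect_ind_l => [|x z xz _]; first by left; exact: connect0.
have [E|zc] := eqVneq z c.
  rewrite E move_edge_c in xz; rewrite (eqP xz) E.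
  move=> [cy|[cs _]]; last by have := ncs; rewrite cs.
  by right; split=> //; exact: connect0.
rewrite (move_edge_neq _ zc) in xz.
move=> [zy|[zs cy]]; [left|right; split=> //];
  exact: connect_trans (connect1 xz) _.
Qed.

Lemma move_acyclic : acyclic move_edge.
Proof.
move=> x y xy; apply/negP => /move_connect H.
have [E|yc] := eqVneq y c.
  rewrite E move_edge_c in xy; rewrite E (eqP xy) in H.
  by have := ncs; case: H => [->|[->]].
rewrite (move_edge_neq _ yc) in xy.
case: H => [yx|[ys cx]]; first by have := ac xy; rewrite yx.
by have := ncs; rewrite (connect_trans cx (connect_trans (connect1 xy) ys)).
Qed.

Lemma graft_acyclic : acyclic graft_edge.
Proof.
have back u v : connect graft_edge u (inl v) ->
    if u is inl y then is_true (connect move_edge y v) else False.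
  move: u; apply: connect_ind_l => [|[x|[]] [y|[]]] //=.
  by move=> xy _; apply: connect_trans (connect1 xy).
move=> [x|[]] [y|[]] //=.
- by move=> xy; apply/negP => /back; apply/negP; exact: move_acyclic.
- by move=> _; apply/negP => /back.
move=> _; apply/negP => /connectP[[|[z|[]] p]] //=.
Qed.

Lemma graft_indeg y : indeg graft_edge (inl y) = indeg e y.
Proof.
rewrite !indegE big_sumType /= big_bool /= !addn0 /move_edge.
case: (y == c) => //.
by rewrite [RHS](reindex_inj (@perm_inj _ (tperm s b))).
Qed.

(** [b] trades [c] for the new reticulation, while [s] receives both as children. *)
Lemma graft_outdeg x :
  outdeg graft_edge (inl x) = if x == s then 2 else outdeg e x.
Proof.
rewrite !outdegE big_sumType /= big_bool /= (bigD1 c) //= move_edge_c.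
rewrite (eq_bigr (fun y => e x y : nat)); last first.
  by move=> y yc; rewrite move_edge_neq.
have [->|xs] := eqVneq x s.
  by rewrite big1 // => y _; rewrite es.
rewrite [RHS](bigD1 c) //=; have [->|xb] := eqVneq x b; first by rewrite ebc addnC.
suff -> : e x c = false by rewrite !addn0.
apply/negP => exc; have := indeg1_uniq (branching_child_indeg ebc) exc ebc.
by move/eqP; rewrite (negbTE xb).
Qed.

Lemma graft_tree x : is_tree graft_edge (inl x) = (x == s) || is_tree e x.
Proof.
rewrite /is_tree /has_deg graft_indeg graft_outdeg.
by have [->|//] := eqVneq x s; rewrite (leaf_deg N ls).
Qed.

Lemma graft_ret x : is_ret graft_edge (inl x) = is_ret e x.
Proof.
rewrite /is_ret /has_deg graft_indeg graft_outdeg.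
by have [->|//] := eqVneq x s; rewrite (leaf_deg N ls).
Qed.

Lemma graft_leaf x : is_leaf graft_lab (inl x) = (x != s) && is_leaf lab x.
Proof.
apply/codomP/andP => [[i]|[xs /codomP[i E]]].
  rewrite /graft_lab; case: eqP => // /eqP ns [->]; split=> //; exact: codom_f.
by exists i; rewrite /graft_lab -E (negbTE xs).
Qed.

Lemma graft_leaf_new : is_leaf graft_lab (inr true).
Proof.
have /codomP[i E] := ls; apply/codomP; exists i.
by rewrite /graft_lab -E eqxx.
Qed.

Lemma graft_nleaf_ret : is_leaf graft_lab (inr false) = false.
Proof. by apply/codomP => -[i]; rewrite /graft_lab; case: ifP. Qed.

Lemma graft_ret_new : is_ret graft_edge (inr false).
Proof.
rewrite /is_ret /has_deg indegE outdegE !big_sumType !big_bool /=.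
rewrite (bigD1 s) //= eqxx (bigD1 b) /= ?eqxx ?orbT; last by rewrite eq_sym.
by rewrite !big1 // => x; case: (x == s) => //; case: (x == b).
Qed.

Lemma graft_deg_new : has_deg graft_edge (inr true) 1 0.
Proof.
by rewrite /has_deg indegE outdegE !big_sumType !big_bool /= !big1.
Qed.

Lemma graft_network : simplex_tree_child graft_edge (inl o) graft_lab.
Proof.
have nt x : is_leaf lab x -> is_tree e x = false.
  by move=> lx; apply: contraTF lx; exact: (tree_nleaf N).
have types v : v != inl o -> ~~ is_leaf graft_lab v ->
    is_tree graft_edge v || is_ret graft_edge v.
  case: v => [x xo|[]]; rewrite ?graft_leaf_new ?graft_ret_new ?orbT //.
  rewrite graft_leaf graft_tree graft_ret.
  have [//|xs /= nl] := eqVneq x s.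
  exact: (stc_inner_deg N xo nl).
have ldeg v : is_leaf graft_lab v -> has_deg graft_edge v 1 0.
  case: v => [x|[]]; rewrite ?graft_nleaf_ret ?graft_deg_new //.
  rewrite graft_leaf => /andP[xs lx].
  by rewrite /has_deg graft_indeg graft_outdeg (negbTE xs); exact: stc_leaf_deg N _ lx.
have os : o != s by rewrite eq_sym (leaf_nroot N ls).
split => //.
- exact: graft_acyclic.
- rewrite /has_deg graft_indeg graft_outdeg (negbTE os); exact: stc_root_deg N.
- apply: (acyclic_reach graft_acyclic) => v vo; apply: indeg_parent.
  have [/ldeg/andP[/eqP->//]|nl] := boolP (is_leaf graft_lab v).
  by case/orP: (types _ vo nl) => /andP[/eqP->].
- move=> i j; rewrite /graft_lab; case: eqP => [E|_]; case: eqP => [E'|_] //.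
    by move=> _; apply: (stc_lab_inj N); rewrite E E'.
  by case; exact: (stc_lab_inj N).
- move=> [x|[]]; rewrite ?graft_leaf_new //; last first.
    by move=> _; exists (inr true); rewrite ?graft_leaf_new ?orbT.
  have good y : y != s -> is_tree e y || is_leaf lab y ->
      is_tree graft_edge (inl y) || is_leaf graft_lab (inl y).
    by move=> ys; rewrite graft_tree graft_leaf (negbTE ys).
  have good' y : is_tree e y || is_leaf lab y ->
      is_tree graft_edge (inl y) || is_leaf graft_lab (inl y).
    by have [->|ys] := eqVneq y s; [rewrite graft_tree eqxx|exact: good].
  (* As [b] is branching, its children are tree vertices or leaves: [c] then serves as the required
     child of [s], and the remaining child as that of [b]. *)
  have ndr y : e b y -> is_tree e y || is_leaf lab y.
    move=> eby; rewrite orbC -implyNb; apply/implyP => nl.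
    have := stc_inner_deg N (edge_nroot N eby) nl.
    by rewrite (negbTE (branching_child_nret eby)) orbF.
  rewrite graft_leaf; have [->|xs /= nl] := eqVneq x s.
    move=> _; exists (inl c); first by rewrite /= move_edge_c.
    exact: good' (ndr _ ebc).
  have [->|xb] := eqVneq x b.
    have /card_gt1P[c1 [c2 []]] : 1 < outdeg e b by rewrite (tree_deg tb).
    rewrite !inE => b1 b2 c12.
    have [d bd dc] : exists2 d, e b d & d != c.
      have [E|?] := eqVneq c1 c; last by exists c1.
      by exists c2 => //; rewrite -E eq_sym.
    exists (inl d); first by rewrite /= move_edge_neq.
    exact: good' (ndr _ bd).
  have [w xw tw] := stc_tree_child N nl; exists (inl w); last exact: good'.
  rewrite /= move_edge_neq //; apply: contraNneq xb => E; rewrite E in xw.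
  by apply/eqP; apply: indeg1_uniq (branching_child_indeg ebc) xw ebc.
- move=> [x|[]] [y|[]] //=; rewrite ?graft_ret ?graft_leaf ?graft_leaf_new //.
    move=> rx; have [->|yc] := eqVneq y c.
      rewrite move_edge_c => /eqP E; move: (ret_nleaf N rx).
      by rewrite E ls.
    rewrite move_edge_neq // => exy; rewrite (stc_one_component N rx exy) andbT.
    (* The leaf below a reticulation differs from [s], which is bare, and so it remains a leaf. *)
    apply: contraTneq exy => ->; case/andP: bs => _ /existsPn/(_ x).
    by rewrite rx andbT.
  move=> rx /orP[] /eqP E; first by move: (ret_nleaf N rx); rewrite E ls.
  by move: (ret_ntree rx); rewrite E tb.
Qed.

(** The old edges are recovered without naming [c], which is now the only child of [s] among the old
    vertices. *)
Lemma move_edgeK x y :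
  e x y = if move_edge s y then x == b else move_edge x y.
Proof.
have [->|yc] := eqVneq y c; last by rewrite !move_edge_neq // es.
rewrite move_edge_c eqxx; apply/idP/eqP => [ec|->//].
exact: indeg1_uniq (branching_child_indeg ebc) ec ebc.
Qed.

Lemma graft_common_child u :
  graft_edge (inl s) u -> graft_edge (inl b) u -> u = inr false.
Proof.
case: u => [y|[]] //=; have [->|yc] := eqVneq y c.
  by rewrite move_edge_c => _; rewrite move_edge_c eq_sym (negbTE sb).
by rewrite move_edge_neq // es.
Qed.

End Graft.

Definition grafted n (M : marked_net n) (c : mvert M) : marked_net n :=
  MarkedNet (graft_edge (@medge n M) (mark1 M) (mark2 M) c) (inl (mroot M))
    (graft_lab (@mlab n M) (mark1 M)) (inl (mark1 M)) (inl (mark2 M)).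

(** The new reticulation is the only common child of the two marks, and the new leaf is its only
    child; so the isomorphism restricts to the old vertices. By [move_edgeK] the restriction
    respects the old edges, and in this way the chosen children need not be matched in advance. *)
Lemma graft_iso n (M1 M2 : marked_net n) (c1 : mvert M1) (c2 : mvert M2) :
  mnetwork M1 -> mnetwork M2 ->
  bare_leaf (@medge n M1) (@mlab n M1) (mark1 M1) ->
  branching (@medge n M1) (mark2 M1) -> medge (mark2 M1) c1 ->
  bare_leaf (@medge n M2) (@mlab n M2) (mark1 M2) ->
  branching (@medge n M2) (mark2 M2) -> medge (mark2 M2) c2 ->
  marked_iso (grafted c1) (grafted c2) -> marked_iso M1 M2.
Proof.
move=> N1 N2 ls1 bb1 bc1 ls2 bb2 bc2 [f [fb fr fl fe] [/= fs fm]].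
have ff : f (inr false) = inr false.
  apply: (@graft_common_child n _ _ (mroot M2) (@mlab n M2) N2 (mark1 M2) (mark2 M2) ls2 bb2 c2 bc2).
    by have := fe (inl (mark1 M1)) (inr false); rewrite fs /= (eqxx (mark1 M1)) => ->.
  by have := fe (inl (mark2 M1)) (inr false); rewrite fm /= (eqxx (mark2 M1)) orbT => ->.
have ft : f (inr true) = inr true.
  have := fe (inr false) (inr true); rewrite ff /=.
  by case: (f (inr true)) => // -[].
(* The default [mark1 M2] is never reached: both [inr] vertices are images of [inr] vertices. *)
pose g x := if f (inl x) is inl y then y else mark1 M2.
have fg x : f (inl x) = inl (g x).
  rewrite /g; case E: (f (inl x)) => [//|[]].
    by have := bij_inj fb (etrans E (esym ft)).
  by have := bij_inj fb (etrans E (esym ff)).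
have gs : g (mark1 M1) = mark1 M2 by have := fg (mark1 M1); rewrite fs => -[].
have gm : g (mark2 M1) = mark2 M2 by have := fg (mark2 M1); rewrite fm => -[].
have g_inj : injective g.
  move=> x y gxy; have : f (inl x) = f (inl y) by rewrite !fg gxy.
  by move/(bij_inj fb) => -[].
have gb : bijective g.
  apply: inj_card_bij g_inj _.
  by have := bij_eq_card fb; rewrite /= !card_sum => /addIn ->.
exists g => //; split => //.
- by have := fg (mroot M1); rewrite fr => -[].
- move=> i; have := fl i; rewrite /= /graft_lab.
  have [E|ns1] := eqVneq (mlab M1 i) (mark1 M1).
    rewrite ft; case: eqP => // E' _; by rewrite E gs E'.
  by rewrite fg; case: eqP => // _ [].
- move=> x y.
  rewrite (move_edgeK N2 ls2 bb2 bc2) (move_edgeK N1 ls1 bb1 bc1).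
  have fe' u w : move_edge (@medge n M2) (mark1 M2) (mark2 M2) c2 (g u) (g w) =
      move_edge (@medge n M1) (mark1 M1) (mark2 M1) c1 u w.
    by have := fe (inl u) (inl w); rewrite !fg.
  have -> : (g x == mark2 M2) = (x == mark2 M1) by rewrite -gm (inj_eq g_inj).
  by rewrite -(fe' (mark1 M1)) gs fe'.
Qed.

Definition siblings (V : finType) (e : rel V) (x y : V) : Prop :=
  x != y /\ exists w, [/\ is_ret e w, e x w & e y w].

Lemma graft_count n :
  count_marks (fun M : marked_net n =>
      bare_leaf (@medge n M) (@mlab n M) (mark1 M) /\
      branching (@medge n M) (mark2 M))
  <= count_marks (fun M : marked_net n => siblings (@medge n M) (mark1 M) (mark2 M)).
Proof.
pose Sw (M M' : marked_net n) := exists c : mvert M,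
  [/\ bare_leaf (@medge n M) (@mlab n M) (mark1 M),
      branching (@medge n M) (mark2 M), medge (mark2 M) c & M' = grafted c].
apply: (switching (Sw := Sw)).
- move=> M nM [ls bb]; have [c bc ncs] := graft_child nM ls bb.
  exists (grafted c); split; first exact: (graft_network nM).
    by exists c.
  split.
    apply/eqP => -[E]; case/andP: ls => ls _; case/andP: bb => tb _.
    by move: (tree_nleaf nM tb); rewrite -E ls.
  exists (inr false); split; rewrite /= ?eqxx ?orbT //.
  exact: (graft_ret_new nM).
- move=> M M' [f fi [<- <-]] [xy [w [rw xw yw]]]; have [fb _ _ fe] := fi.
  split; first by rewrite (bij_eq fb).
  by exists (f w); rewrite (is_iso_ret fi) !fe.
move=> M1 M2 _ _ N1 N2 [c1 [ls1 bb1 bc1 ->]] [c2 [ls2 bb2 bc2 ->]].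
exact: graft_iso.
Qed.

(** * Counting consequences *)

Section Extend.
Variables (n : nat) (V : finType) (e : rel V) (o : V) (lab : 'I_n -> V).
Hypothesis N : simplex_tree_child e o lab.

(* [inr false] is the new root and [inr true] the new leaf. *)
Definition extend_edge : rel (V + bool) := fun u w =>
  match u, w with
  | inl x, inl y => e x y
  | inl x, inr true => x == o
  | inr false, inl y => y == o
  | _, _ => false
  end.

Definition extend_lab (i : 'I_n.+1) : V + bool :=
  if unlift ord_max i is Some j then inl (lab j) else inr true.

Lemma extend_indeg y : indeg extend_edge (inl y) = (indeg e y + (y == o))%N.
Proof. by rewrite !indegE big_sumType /= big_bool. Qed.

Lemma extend_outdeg x : outdeg extend_edge (inl x) = (outdeg e x + (x == o))%N.
Proof. by rewrite !outdegE big_sumType /= big_bool /= addn0. Qed.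

Lemma extend_tree x : is_tree extend_edge (inl x) = (x == o) || is_tree e x.
Proof.
rewrite /is_tree /has_deg extend_indeg extend_outdeg.
by have [->|_] := eqVneq x o; rewrite ?(root_deg N) // !addn0.
Qed.

Lemma extend_ret x : is_ret extend_edge (inl x) = is_ret e x.
Proof.
rewrite /is_ret /has_deg extend_indeg extend_outdeg.
by have [->|_] := eqVneq x o; rewrite ?(root_deg N) // !addn0.
Qed.

Lemma extend_leaf x : is_leaf extend_lab (inl x) = is_leaf lab x.
Proof.
apply/codomP/codomP => -[i].
  by rewrite /extend_lab; case: unlift => // j [->]; exists j.
by move=> ->; exists (lift ord_max i); rewrite /extend_lab liftK.
Qed.

Lemma extend_leaf_new : is_leaf extend_lab (inr true).
Proof. by apply/codomP; exists ord_max; rewrite /extend_lab unlift_none. Qed.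

Lemma extend_leaf_root : is_leaf extend_lab (inr false) = false.
Proof. by apply/codomP => -[i]; rewrite /extend_lab; case: unlift. Qed.

Lemma sum_eq1 (z : V) : \sum_v (v == z : nat) = 1.
Proof. by rewrite (bigD1 z) //= eqxx big1 // => v /negbTE->. Qed.

Lemma extend_deg_new : has_deg extend_edge (inr true) 1 0.
Proof.
by rewrite /has_deg indegE outdegE !big_sumType !big_bool /= sum_eq1 big1.
Qed.

Lemma extend_deg_root : has_deg extend_edge (inr false) 0 1.
Proof.
by rewrite /has_deg indegE outdegE !big_sumType !big_bool /= sum_eq1 big1.
Qed.

Lemma extend_acyclic : acyclic extend_edge.
Proof.
have back u v : connect extend_edge (inl u) v ->
    if v is inl y then is_true (connect e u y) else v = inr true.
  move: v; apply: connect_ind_r => [|[x|[]] [y|[]]] //=.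
  by move=> _ xy ux; apply: connect_trans ux (connect1 xy).
move=> [x|[]] [y|[]] //=.
- by move=> xy; apply/negP => /back; apply/negP; exact: (stc_acyclic N).
- by move=> _; apply/negP => /connectP[[|[z|[]] p]].
- by move=> _; apply/negP => /back.
Qed.

Lemma extend_network : simplex_tree_child extend_edge (inr false) extend_lab.
Proof.
have types v : v != inr false -> ~~ is_leaf extend_lab v ->
    is_tree extend_edge v || is_ret extend_edge v.
  case: v => [x _|[]]; rewrite ?extend_leaf_new //.
  rewrite extend_leaf extend_tree extend_ret.
  by have [//|xo nl] := eqVneq x o; exact: (stc_inner_deg N xo nl).
have ldeg v : is_leaf extend_lab v -> has_deg extend_edge v 1 0.
  case: v => [x|[]]; rewrite ?extend_leaf_root ?extend_deg_new //.
  rewrite extend_leaf => lx; rewrite /has_deg extend_indeg extend_outdeg.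
  by rewrite (negbTE (leaf_nroot N lx)) !addn0; exact: stc_leaf_deg N _ lx.
split => //.
- exact: extend_acyclic.
- exact: extend_deg_root.
- apply: (acyclic_reach extend_acyclic) => v vo; apply: indeg_parent.
  have [ /ldeg/andP[/eqP->//]|nl] := boolP (is_leaf extend_lab v).
  by case/orP: (types _ vo nl) => /andP[/eqP->].
- move=> i j; rewrite /extend_lab.
  case: unliftP => [i' ->|->]; case: unliftP => [j' ->|->] //.
  by case=> /(stc_lab_inj N) ->.
- move=> [x|[]]; rewrite ?extend_leaf_new // => nl; last first.
    by exists (inl o); rewrite /= ?extend_tree ?eqxx.
  rewrite extend_leaf in nl; have [w xw tw] := stc_tree_child N nl.
  exists (inl w) => //; rewrite extend_tree extend_leaf.
  by case/orP: tw => ->; rewrite ?orbT.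
- move=> [x|[]] [y|[]] //=; rewrite ?extend_ret ?extend_leaf ?extend_leaf_new //.
    exact: (stc_one_component N).
  by case/andP: extend_deg_root => /eqP E _ /andP[/eqP]; rewrite E.
Qed.

End Extend.

(** A root above one leaf, to start with; then the old root is turned into a tree vertex below a new
    root and above a new leaf. Averages over [networks n] are therefore genuine for positive [n]. *)
Lemma network_exists n : exists (V : finType) (e : rel V) (o : V) (lab : 'I_n.+1 -> V),
  simplex_tree_child e o lab.
Proof.
elim: n => [|n [V [e [r [lab N]]]]]; last first.
  exists (V + bool)%type, (extend_edge e r), (inr false), (extend_lab lab).
  exact: extend_network.
pose e : rel bool := fun x y => ~~ x && y.
have di v : indeg e v = v.
  by rewrite indegE big_bool; case: v.
have dq v : outdeg e v = ~~ v.
  by rewrite outdegE big_bool; case: v.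
have lf v : is_leaf (fun _ : 'I_1 => true) v = v.
  apply/codomP/idP => [[i ->] //|->]; by exists ord0.
have ac : acyclic e.
  by move=> [] [] // _; apply/negP => /connectP[[|z p] //=].
exists bool, e, false, (fun _ => true); split => //.
- by rewrite /has_deg di dq.
- by apply: (acyclic_reach ac) => -[] // _; exists false.
- by move=> i j _; rewrite !ord1.
- by move=> v; rewrite lf /has_deg di dq => ->.
- by move=> v; rewrite lf; case: v.
- by move=> v; rewrite lf => nv; exists true; rewrite ?lf ?orbT // /e nv.
- by move=> v w; rewrite /is_ret /has_deg di; case: v.
Qed.

Lemma card_networks_gt0 n : 0 < #|networks n.+1|.
Proof.
have [V [e [r [lab N]]]] := network_exists n.
have [M [x [y [MX _ _]]]] := @networks_rep n.+1 (MarkedNet e r lab r r) N.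
by apply/card_gt0P; exists M.
Qed.

(** * Mean numbers of bare leaves and of vertices on short cycles *)

Definition reps n (N : prenet n) : nat := nret (@nedge n N).

Lemma card_pairs (V : finType) (P Q : pred V) :
  #|[pred xy : V * V | P xy.1 && Q xy.2]| = (#|P| * #|Q|)%N.
Proof. by rewrite -cardX; apply: eq_card => -[x y]; rewrite !inE. Qed.

(** There are [n - reps N] bare leaves and one branching vertex fewer. On the other side, an ordered
    pair of parents of a reticulation is determined by its first member, which is one of
    [2 * reps N] decorated vertices. *)
Lemma sum_bare_le n :
  (\sum_(N in networks n) (n - reps N) * (n - reps N).-1
     <= #|networks n| * (2 * n))%N.
Proof.
have := graft_count n; rewrite /count_marks => H.
apply: leq_trans (leq_trans H _).
  apply: leq_sum => N /networks_network NN.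
  have -> : (n - reps N)%N = #|bare_leaf (@nedge n N) (@nlab n N)|.
    by have := card_ret_leaf NN; rewrite /reps; lia.
  have -> : #|bare_leaf (@nedge n N) (@nlab n N)|.-1 = #|branching (@nedge n N)|.
    by have := card_ret_leaf NN; have := card_branching NN; lia.
  rewrite -card_pairs; apply: subset_leq_card; apply/fintype.subsetP => -[x y].
  by rewrite !inE /= => /andP[].
rewrite -sum_nat_const; apply: leq_sum => N /networks_network NN.
apply: (@leq_trans #|decorated_tree (@nedge n N)|); last first.
  by rewrite (card_decorated NN) leq_mul2l /=; have := card_ret_leaf NN; lia.
rewrite -(@card_in_image _ _ fst).
  apply: subset_leq_card; apply/fintype.subsetP => _ /fintype.imageP[[x y] xyP ->].
  have /asboolP[_ [w [rw xw _]]] : `[< siblings (@nedge n N) x y >] := xyP.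
  have dx : decorated_tree (@nedge n N) x by apply/(decoratedP NN); exists w.
  exact: dx.
move=> [x y] [x' y'] xyP xyP' /= E.
have /asboolP[xy [w [rw xw yw]]] : `[< siblings (@nedge n N) x y >] := xyP.
have /asboolP[xy' [w' [rw' xw' yw']]] : `[< siblings (@nedge n N) x' y' >] := xyP'.
rewrite -E in xy' xw' *.
have E' := ret_child_uniq NN xw' xw rw' rw; rewrite E' in yw'.
congr (_, _); apply/eqP/negP => /negP yy'.
apply: (@card_gt2_contra _ [pred u | nedge u w] x y y') => //; first exact: (ret_deg rw).1.
by rewrite eq_sym.
Qed.

Definition bad_cycle n L (N : prenet n) : {set nvert N} :=
  [set x | `[< short_cycle (@nedge n N) L x >]]%SET.

(* The subtraction is truncated: the bound says nothing when [reps N] is small. *)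
Lemma sum_cycle_le n L :
  (\sum_(N in networks n) #|bad_cycle L N| * (2 * reps N - 4 ^ L)
     <= #|networks n| * (4 * n * 4 ^ (L + 2)))%N.
Proof.
have := swap_count n L; rewrite /count_marks => H.
apply: leq_trans (leq_trans H _); last first.
  rewrite -sum_nat_const; apply: leq_sum => N /networks_network NN.
  apply: (@leq_trans (\sum_(y : nvert N) \sum_x nearby (@nedge n N) (L + 2) y x)).
    rewrite exchange_big pair_big /= sum_pred; apply: subset_leq_card.
    apply/fintype.subsetP => -[x y] xyP.
    by have /asboolP : `[< nearby (@nedge n N) (L + 2) y x >] := xyP.
  apply: (@leq_trans (\sum_(y : nvert N) 4 ^ (L + 2))).
    by apply: leq_sum => y _; rewrite sum_pred; apply/card_nearby/(deg_le3 NN).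
  by rewrite sum_nat_const leq_mul2r (stc_card_le NN) orbT.
apply: leq_sum => N /networks_network NN; set e := @nedge n N.
apply: (@leq_trans (\sum_(x in bad_cycle L N)
    #|[pred y | `[< exists2 a, on_short_cycle e L x a &
        decorated_tree e y /\ ~~ nearby e L a y >]]|)).
  rewrite -sum_nat_const; apply: leq_sum => x; rewrite inE => /asboolP[a ca].
  (* Among the [2 * reps N] decorated vertices at most [4 ^ L] are near [a]; all others are
     admissible partners for the exchange. *)
  rewrite leq_subLR; have <- : #|decorated_tree e| = (2 * reps N)%N := card_decorated NN.
  apply: (@leq_trans (#|nearby e L a| + #|[pred y | decorated_tree e y && ~~ nearby e L a y]|)).
    rewrite -!sum_pred -big_split /=; apply: leq_sum => y _.
    by case: (decorated_tree e y); case: (nearby e L a y).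
  apply: leq_add; first exact/card_nearby/(deg_le3 NN).
  apply: subset_leq_card; apply/fintype.subsetP => y /andP[dy ny].
  have : `[< exists2 a, on_short_cycle e L x a &
        decorated_tree e y /\ ~~ nearby e L a y >] by apply/asboolP; exists a.
  exact.
under eq_bigr do rewrite -sum1_card.
rewrite pair_big_dep /= sum1_card; apply: subset_leq_card; apply/fintype.subsetP => -[x y].
by case/andP.
Qed.

(** * Short cycles and injectivity of tree-like maps *)

Section ShortCycle.
Variables (n : nat) (V : finType) (e : rel V) (o : V) (lab : 'I_n -> V).
Hypothesis N : simplex_tree_child e o lab.

Local Notation adj := (adj e).

Lemma on_short_cycle_le L L' x a :
  L <= L' -> on_short_cycle e L x a -> on_short_cycle e L' x a.
Proof.
move=> le [w [p [? [pp lp sp wp]]]]; exists w, p; split=> //; split=> //.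
exact: leq_trans sp le.
Qed.

Lemma two_parents_ret w a b : e a w -> e b w -> a != b -> is_ret e w.
Proof.
move=> aw bw ab; apply/negPn/negP => nr.
have i1 := nret_indeg1 N (edge_nroot N aw) nr.
by rewrite (indeg1_uniq i1 aw bw) eqxx in ab.
Qed.

(* The last vertex of a cycle in a topological order is a reticulation whose
   two parents are its neighbours in the cycle. *)
Lemma simple_cycle_short c :
  cycle adj c -> uniq c -> 2 < size c ->
  exists2 x, x \in c & short_cycle e (size c) x.
Proof.
move=> cyc un sz.
have [x0 x0c] : exists x0, x0 \in c.
  by case: c sz {cyc un} => // x0 c0; exists x0; rewrite mem_head.
pose w := [arg min_(x < x0 in c) rank e x]%N.
have [wc wmin] : w \in c /\ forall y, y \in c -> rank e w <= rank e y.
  by rewrite /w; case: arg_minnP.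
have sink y : y \in c -> adj w y -> e y w.
  move=> yc /orP[wy|//]; have := rank_lt (stc_acyclic N) wy.
  by rewrite ltnNge wmin.
have [i s E] := rot_to wc.
have us : uniq (w :: s) by rewrite -E rot_uniq.
have cs : path adj w (rcons s w) by have : cycle adj (w :: s) by rewrite -E rot_cycle.
have ss : size (w :: s) = size c by rewrite -E size_rot.
have sub y : y \in w :: s -> y \in c by rewrite -E mem_rot.
case/andP: us => ws us; case: s E ws us cs ss sub => [|a p] E ws us cs ss sub.
  by rewrite -ss in sz.
move: cs; rewrite /= rcons_path => /and3P[wa pp lw].
exists (last a p).
  by apply: sub; rewrite inE mem_last orbT.
have ea : e a w by apply: sink => //; apply: sub; rewrite !inE eqxx orbT.
have el : e (last a p) w.
  apply: sink; first by apply: sub; rewrite inE mem_last orbT.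
  by rewrite adj_sym.
have al : a != last a p.
  case: p us pp {E ws lw sub el} ss => [|b p] /=; first by move=> _ _ ss; rewrite -ss in sz.
  by case/andP => + _ _ _; apply: contraNneq => ->; rewrite mem_last.
exists a, w, p; split; first by split => //; exact: two_parents_ret ea el al.
split => //; first by rewrite -ss /= -addn2 leq_addr.
by apply: contraNN ws; rewrite inE => ->; rewrite orbT.
Qed.

Fixpoint reduced (s : seq V) : bool :=
  if s is x :: s' then
    (if s' is _ :: z :: _ then x != z else true) && reduced s'
  else true.

(** In the shortest suffix with a repetition, the first vertex recurs and the stretch up to its
    recurrence is a simple cycle. It has more than two vertices since there are no loops and the
    walk does not backtrack. *)
Lemma reduced_cycle x p : path adj x p -> reduced (x :: p) -> ~~ uniq (x :: p) ->
  exists c, [/\ cycle adj c, uniq c, 2 < size c, size c <= size p &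
                {subset c <= x :: p}].
Proof.
elim: p x => [|y p IH] x //; move=> xp rp nu.
have [up|nup] := boolP (uniq (y :: p)); last first.
  have [//||c [cc uc c2 sc cp]] := IH y _ _ nup.
  - by case/andP: xp.
  - by case/andP: rp.
  exists c; split => //; first exact: leqW.
  by move=> z /cp; rewrite !inE => ->; rewrite orbT.
have xin : x \in y :: p by move: nu; rewrite cons_uniq up andbT negbK.
case/splitPr: xin (up) xp rp {IH nu} => p1 p2 up1 xp rp.
exists (x :: p1); split.
- move: xp; rewrite cat_path /= => /and3P[xp1 l _].
  by rewrite rcons_path xp1.
- by move: up1; rewrite cat_uniq /= => /and3P[-> /norP[-> _] _].
- case: p1 xp rp {up1} => [|z [|? ?]] //=.
    by rewrite (adj_irr (stc_acyclic N)).
  by rewrite eqxx.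
- by rewrite size_cat /= addnS ltnS leq_addr.
by move=> z; rewrite !inE mem_cat => /orP[->//|->]; rewrite orbT.
Qed.

End ShortCycle.

(** * Paths in a rooted tree and injectivity of maps out of it *)

Section TreePath.
Variables (D : eqType) (root : D) (par : D -> D) (depth : D -> nat).
Hypothesis depth_root : depth root = 0.
Hypothesis depth_par : forall x, x != root -> depth x = (depth (par x)).+1.

Definition tree_adj : rel D := fun x y =>
  (x != root) && (y == par x) || (y != root) && (x == par y).

(** The deeper end, or both ends if they are level, is replaced by its parent. The path obtained by
    induction has smaller depth throughout and so avoids the ends that are put back. *)
Lemma tree_path x y : exists p,
  [/\ path tree_adj x p, last x p = y, uniq (x :: p),
      all (fun z => depth z <= maxn (depth x) (depth y)) (x :: p) &
      size p <= depth x + depth y].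
Proof.
have [m] := ubnP (depth x + depth y); elim: m x y => // m IH x y lt_m.
have up z : 0 < depth z -> z != root by apply: contraTneq => ->; rewrite depth_root.
have [->|xy] := eqVneq x y; first by exists [::]; rewrite /= maxnn leqnn.
have [lt_yx|lt_xy|E] := ltngtP (depth y) (depth x).
- have xr : x != root by apply: up; apply: leq_ltn_trans lt_yx.
  have dx := depth_par xr.
  have [|p [pp lp up' dp sp]] := IH (par x) y; first by lia.
  have dp' : all (fun z => depth z < depth x) (par x :: p).
    by apply/allP => z /(allP dp) dz; apply: leq_ltn_trans dz _; lia.
  exists (par x :: p); split => //.
  + by rewrite /= pp /tree_adj xr eqxx.
  + rewrite cons_uniq up' andbT; apply/negP => /(allP dp') /=.
    by rewrite ltnn.
  + by apply/allP => z; rewrite inE => /orP[/eqP->//|/(allP dp') /= /ltnW].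
  + by rewrite /=; lia.
- have yr : y != root by apply: up; apply: leq_ltn_trans lt_xy.
  have dy := depth_par yr.
  have [|p [pp lp up' dp sp]] := IH x (par y); first by lia.
  have dp' : all (fun z => depth z < depth y) (x :: p).
    by apply/allP => z /(allP dp) dz; apply: leq_ltn_trans dz _; lia.
  exists (rcons p y); split.
  + by rewrite rcons_path pp /= lp /tree_adj yr eqxx orbT.
  + by rewrite last_rcons.
  + rewrite -rcons_cons rcons_uniq up' andbT; apply/negP => /(allP dp') /=.
    by rewrite ltnn.
  + apply/allP => z; rewrite -rcons_cons mem_rcons inE.
    by case/orP => [/eqP->//|/(allP dp') /= /ltnW].
  + by rewrite size_rcons; lia.
have xr : x != root.
  apply: contraNneq xy => xr; have : depth y = 0 by rewrite E xr depth_root.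
  by have [->|/depth_par ->//] := eqVneq y root; rewrite xr.
have yr : y != root by apply: up; rewrite E (depth_par xr).
have dx := depth_par xr; have dy := depth_par yr.
have [|p [pp lp up' dp sp]] := IH (par x) (par y); first by lia.
have dp' : all (fun z => depth z < depth x) (par x :: p).
  by apply/allP => z /(allP dp) dz; apply: leq_ltn_trans dz _; lia.
exists (par x :: rcons p y); split.
- by rewrite /= rcons_path pp lp /tree_adj xr yr !eqxx orbT.
- by rewrite /= last_rcons.
- rewrite -rcons_cons -[_ :: _]/(x :: rcons (par x :: p) y) cons_uniq rcons_uniq up' andbT.
  apply/andP; split; last by apply/negP => /(allP dp') /=; rewrite E ltnn.
  rewrite mem_rcons inE negb_or xy; apply/negP => /(allP dp') /=.
  by rewrite ltnn.
- apply/allP => z; rewrite -rcons_cons inE mem_rcons inE.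
  by case/or3P => [/eqP->|/eqP->|/(allP dp') /= /ltnW] //; rewrite E.
- by rewrite /= size_rcons; lia.
Qed.

Section Injective.
Variables (n : nat) (V : finType) (e : rel V) (o : V) (lab : 'I_n -> V).
Hypothesis N : simplex_tree_child e o lab.
Variables (phi : D -> V) (K : nat).
Hypothesis phi_adj : forall z y, depth z <= K -> tree_adj z y -> adj e (phi z) (phi y).
Hypothesis phi_loc_inj : forall z y y', depth z <= K -> tree_adj z y ->
  tree_adj z y' -> phi y = phi y' -> y = y'.
Hypothesis no_cycle : forall z, depth z <= K -> ~ short_cycle e (2 * K) (phi z).

(** Otherwise the path between [x] and [y], of at most [2 * K] steps, is mapped to a reduced closed
    walk. A cycle in that walk puts the image of a vertex of depth at most [K] on a short cycle. *)
Lemma tree_map_inj x y : depth x <= K -> depth y <= K -> phi x = phi y -> x = y.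
Proof.
move=> dx dy pxy; apply/eqP/negPn/negP => xy.
have [p [pp lp up dp sp]] := tree_path x y.
have {}dp : all (fun z => depth z <= K) (x :: p).
  by apply/allP => z /(allP dp) /= dz; apply: leq_trans dz _; rewrite geq_max dx.
have [] : path (adj e) (phi x) (map phi p) /\ reduced (map phi (x :: p)).
  elim: p x pp up dp {lp sp dx pxy xy} => [|z p IH] x //=.
  move=> /andP[xz pz] /andP[xzp uz] /andP[dx dz].
  have [pp' rp] := IH z pz uz dz; split; first by rewrite phi_adj.
  apply/andP; split; last exact: rp.
  case: p xzp pz {uz IH rp pp'} dz => //= t p xzp /andP[zt _] /andP[dz _].
  apply/eqP => xt; have E : x = t.
    by apply: (phi_loc_inj dz) => //; rewrite /tree_adj orbC.
  by rewrite E !inE eqxx !orbT in xzp.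
move=> pp' rp; have nu : ~~ uniq (phi x :: map phi p).
  rewrite /= negb_and negbK; apply/orP; left.
  have -> : phi x = last (phi x) (map phi p) by rewrite last_map lp.
  case: p lp {pp up dp sp pp' rp} => [|z p] /=; first by move=> E; rewrite E eqxx in xy.
  by rewrite mem_last.
have [c [cc uc c2 sc cp]] := reduced_cycle N pp' rp nu.
have [z zc [a za]] := simple_cycle_short N cc uc c2.
have : z \in map phi (x :: p) by exact: cp.
case/mapP => t tp zE; rewrite zE in za.
apply: (no_cycle (allP dp _ tp)); exists a; apply: on_short_cycle_le za.
by rewrite size_map in sc; lia.
Qed.

End Injective.

End TreePath.

(** * Unfolding a network from a vertex *)

(** Each vertex of the limit networks has such a marked neighbourhood, and the mark determines which
    one. The graph is arbitrary so that the notion applies to the infinite tree and to the network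
    alike. *)
Definition local_type (X : Type) (E : X -> X -> Prop) (M : X -> vmark) (x : X) : Prop :=
  match M x with
  | MTree => exists u d r, [/\ E u x, E x d & E x r] /\
      [/\ M u = MTree, M d = MTree & M r = MRet] /\
      (forall y, E y x -> y = u) /\ (forall y, E x y -> y = d \/ y = r)
  | MRet => exists a b l, a <> b /\ [/\ E a x, E b x & E x l] /\
      [/\ M a = MTree, M b = MTree & M l = MLeaf] /\
      (forall y, E y x -> y = a \/ y = b) /\ (forall y, E x y -> y = l)
  | MLeaf => exists r, E r x /\ M r = MRet /\
      (forall y, E y x -> y = r) /\ (forall y, ~ E x y)
  | MRoot => False
  end.

Section LocalBijection.
Variables (D : Type) (E : D -> D -> Prop) (M : D -> vmark).
Variables (V : Type) (e : V -> V -> Prop) (m : V -> vmark).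
Hypothesis E_asym : forall x y, E x y -> ~ E y x.
Hypothesis e_asym : forall x y, e x y -> ~ e y x.

(** The covering condition at one vertex, respecting orientations and marks. The image [z'] is
    separate from [f z] because in the unfolding the neighbours of each [z] are mapped by an [f]
    chosen for that [z]. *)
Definition local_bijection (f : D -> V) (z : D) (z' : V) : Prop :=
  [/\ forall y, E y z -> e (f y) z' /\ m (f y) = M y,
      forall y, E z y -> e z' (f y) /\ m (f y) = M y,
      forall y y', E y z \/ E z y -> E y' z \/ E z y' -> f y = f y' -> y = y',
      forall u, e u z' -> exists2 y, E y z & f y = u &
      forall u, e z' u -> exists2 y, E z y & f y = u].

Lemma local_bijection_ext f g z z' :
  (forall y, E y z \/ E z y -> f y = g y) ->
  local_bijection f z z' -> local_bijection g z z'.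
Proof.
move=> fg [fin fout finj fsin fsout]; split.
- by move=> y yz; rewrite -fg; [exact: fin|left].
- by move=> y yz; rewrite -fg; [exact: fout|right].
- by move=> y y' yz y'z; rewrite -!fg //; exact: finj.
- by move=> u /fsin[y yz <-]; exists y => //; rewrite fg //; left.
- by move=> u /fsout[y yz <-]; exists y => //; rewrite fg //; right.
Qed.

Lemma fun3 (u d r : D) (u' d' r' : V) : u <> d -> u <> r -> d <> r ->
  exists f : D -> V, [/\ f u = u', f d = d' & f r = r'].
Proof.
move=> ud ur dr.
exists (fun y => if `[< y = u >] then u' else if `[< y = d >] then d' else r').
split; first by rewrite asboolT.
- by rewrite asboolF ?asboolT // => du; exact: ud (esym du).
by rewrite !asboolF // => ru; [apply: dr|apply: ur].
Qed.

Lemma ret_type_pin (X : Type) (F : X -> X -> Prop) (m' : X -> vmark) x w :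
  local_type F m' x -> m' x = MRet -> F w x ->
  exists b l, w <> b /\ [/\ F w x, F b x & F x l] /\
      [/\ m' w = MTree, m' b = MTree & m' l = MLeaf] /\
      (forall y, F y x -> y = w \/ y = b) /\ (forall y, F x y -> y = l).
Proof.
rewrite /local_type => + mx wx; rewrite mx.
move=> [a [b [l [ab [[ax bx xl] [[ma mb ml] [par ch]]]]]]].
case: (par _ wx) => ?; subst w; first by exists b, l.
exists a, l; split; first by move=> ba; exact: ab (esym ba).
split=> //; split=> //; split=> // y /par[]; [right|left]; done.
Qed.

(** Orientation and mark single out each neighbour of [z], except for the two parents of a
    reticulation, which may be interchanged. Hence the image of one neighbour can be prescribed. *)
Lemma local_bijection_pinned z z' w w' :
  local_type E M z -> local_type e m z' -> M z = m z' ->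
  (E w z /\ e w' z') \/ (E z w /\ e z' w') -> M w = m w' ->
  exists2 f, local_bijection f z z' & f w = w'.
Proof.
case Mz: (M z) => + + mz; [by rewrite /local_type Mz| | |].
- rewrite {1 2}/local_type Mz -mz.
  move=> [u [d [r [[uz zd zr] [[Mu Md Mr] [par ch]]]]]].
  move=> [u' [d' [r' [[uz' zd' zr'] [[Mu' Md' Mr'] [par' ch']]]]]] ww Mw.
  have ud : u <> d by move=> E'; subst d; exact: E_asym uz zd.
  have ur : u <> r by move=> E'; subst r; exact: E_asym uz zr.
  have dr : d <> r by move=> E'; subst r; rewrite Md in Mr.
  have ud' : u' <> d' by move=> E'; subst d'; exact: e_asym uz' zd'.
  have ur' : u' <> r' by move=> E'; subst r'; exact: e_asym uz' zr'.
  have dr' : d' <> r' by move=> E'; subst r'; rewrite Md' in Mr'.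
  have [f [fu fd fr]] := @fun3 u d r u' d' r' ud ur dr.
  exists f.
    split.
    + by move=> y /par ->; rewrite fu Mu.
    + by move=> y /ch[->|->]; rewrite ?fd ?fr ?Md ?Mr.
    + move=> y y' [/par ->|/ch[->|->]] [/par ->|/ch[->|->]] //; rewrite ?fu ?fd ?fr => H;
        by [case: (ud' H)|case: (ud' (esym H))|case: (ur' H)|case: (ur' (esym H))
           |case: (dr' H)|case: (dr' (esym H))].
    + by move=> x /par' ->; exists u.
    + by move=> x /ch'[->|->]; [exists d|exists r].
  case: ww => -[]; first by move=> /par -> /par' ->.
  move=> /ch wE /ch' wE'; move: Mw.
  by case: wE => ->; case: wE' => ->; rewrite ?Md ?Mr ?Md' ?Mr'.
- move=> tz tz' ww Mw.
  have [a [a' [az [az' aw]]]] : exists a a', E a z /\ e a' z' /\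
      (E z w /\ e z' w' \/ w = a /\ w' = a').
    case: ww => [[wz wz']|zw]; first by exists w, w'; do 2 split => //; right.
    move: tz tz'; rewrite {1 2}/local_type Mz -mz.
    move=> [a [b [l [ab [[az bz zl] _]]]]] [a' [b' [l' [ab' [[az' bz' zl'] _]]]]].
    by exists a, a'; do 2 split => //; left.
  have [b [l [ab [[_ bz zl] [[Ma Mb Ml] [par ch]]]]]] := ret_type_pin tz Mz az.
  have [b' [l' [ab' [[_ bz' zl'] [[Ma' Mb' Ml'] [par' ch']]]]]] :=
    ret_type_pin tz' (esym mz) az'.
  have al : a <> l by move=> E'; subst l; rewrite Ma in Ml.
  have bl : b <> l by move=> E'; subst l; rewrite Mb in Ml.
  have al' : a' <> l' by move=> E'; subst l'; rewrite Ma' in Ml'.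
  have bl' : b' <> l' by move=> E'; subst l'; rewrite Mb' in Ml'.
  have [f [fa fb fl]] := @fun3 a b l a' b' l' ab al bl.
  exists f.
    split.
    + by move=> y /par[->|->]; rewrite ?fa ?fb ?Ma ?Mb.
    + by move=> y /ch ->; rewrite fl Ml.
    + move=> y y' [/par[->|->]|/ch->] [/par[->|->]|/ch->] //; rewrite ?fa ?fb ?fl => H;
        by [case: (ab' H)|case: (ab' (esym H))|case: (al' H)|case: (al' (esym H))
           |case: (bl' H)|case: (bl' (esym H))].
    + by move=> x /par'[->|->]; [exists a|exists b].
    + by move=> x /ch' ->; exists l.
  by case: aw => [[/ch -> /ch' ->]|[-> ->]].
rewrite {1 2}/local_type Mz -mz.
move=> [r [rz [Mr [par ch]]]] [r' [rz' [Mr' [par' ch']]]] ww Mw.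
exists (fun _ => r'); last by case: ww => [[_ /par' ->]|[/ch]].
split.
- by move=> y /par ->; rewrite Mr Mr'.
- by move=> y /ch.
- by move=> y y' [/par ->|/ch//] [/par ->|/ch//].
- by move=> x /par' ->; exists r.
- by move=> x /ch'.
Qed.

Lemma local_bijection_exists z z' :
  local_type E M z -> local_type e m z' -> M z = m z' ->
  exists f, local_bijection f z z'.
Proof.
move=> tz tz' mz.
have [w [w' [ww Mw]]] : exists w w',
    ((E w z /\ e w' z') \/ (E z w /\ e z' w')) /\ M w = m w'.
  case Mz: (M z) (tz) (tz') => + +; rewrite {1 2}/local_type Mz -mz Mz //.
  - move=> [u [d [r [[uz zd zr] [[Mu Md Mr] _]]]]].
    move=> [u' [d' [r' [[uz' zd' zr'] [[Mu' Md' Mr'] _]]]]].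
    by exists u, u'; split; [left|rewrite Mu].
  - move=> [a [b [l [ab [[az bz zl] [[Ma Mb Ml] _]]]]]].
    move=> [a' [b' [l' [ab' [[az' bz' zl'] [[Ma' Mb' Ml'] _]]]]]].
    by exists a, a'; split; [left|rewrite Ma].
  move=> [r [rz [Mr _]]] [r' [rz' [Mr' _]]].
  by exists r, r'; split; [left|rewrite Mr].
by have [f fb _] := local_bijection_pinned tz tz' mz ww Mw; exists f.
Qed.

End LocalBijection.

Section Unfolding.
Variables (D : eqType) (E : D -> D -> Prop) (M : D -> vmark).
Variables (root : D) (par : D -> D) (depth : D -> nat).
Hypothesis depth_root : depth root = 0.
Hypothesis depth_par : forall x, x != root -> depth x = (depth (par x)).+1.
Hypothesis E_tree : forall x y, E x y -> tree_adj root par x y.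
Hypothesis tree_E : forall x, x != root -> E x (par x) \/ E (par x) x.
Hypothesis E_asym : forall x y, E x y -> ~ E y x.
Hypothesis E_type : forall x, local_type E M x.

Variables (n : nat) (V : finType) (e : rel V) (o : V) (lab : 'I_n -> V).
Hypothesis N : simplex_tree_child e o lab.

Let m := vtype e o lab.

Lemma e_asym (x y : V) : e x y -> ~ e y x.
Proof. by move=> xy yx; have := acyclic_asym (stc_acyclic N) xy; rewrite yx. Qed.

Lemma tree_adjP x y : tree_adj root par x y <-> E x y \/ E y x.
Proof.
split; last by case=> /E_tree; rewrite /tree_adj // orbC.
case/orP => /andP[xr /eqP->]; first exact: tree_E.
by case: (tree_E xr); [right|left].
Qed.

Lemma depth_adj x y : tree_adj root par x y ->
  (x != root /\ y = par x /\ depth x = (depth y).+1) \/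
  (y != root /\ x = par y /\ depth y = (depth x).+1).
Proof.
by case/orP => /andP[r /eqP->]; [left|right]; rewrite (depth_par r).
Qed.

Variables (v : V) (K : nat).
Hypothesis v_mark : m v = M root.
Hypothesis v_type : forall u, nearby e K v u -> local_type e m u.

Definition covering k (phi : D -> V) : Prop :=
  phi root = v /\ forall z, depth z < k -> local_bijection E M e m phi z (phi z).

Lemma covering_near k phi x : covering k phi -> depth x <= k ->
  nearby e (depth x) v (phi x) /\ m (phi x) = M x.
Proof.
move=> [rt cov]; have [d] := ubnP (depth x); elim: d x => // d IH x lt_d dk.
have [->|xr] := eqVneq x root; first by rewrite depth_root rt /=.
have dx := depth_par xr.
have lt1 : depth (par x) < d by lia.
have lt2 : depth (par x) <= k by lia.
have [nx mx] := IH _ lt1 lt2.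
have [fin fout _ _ _] : local_bijection E M e m phi (par x) (phi (par x)).
  by apply: cov; lia.
rewrite dx -addn1; case: (tree_E xr) => [/fin|/fout] [ex mx'].
  by split=> //; apply: nearby_trans nx (nearby_adj _); rewrite /adj ex orbT.
by split=> //; apply: nearby_trans nx (nearby_adj _); rewrite /adj ex.
Qed.

(* At each vertex of the last level, the map is continued by a bijection between
   the neighbourhoods that agrees with it at the parent. *)
Lemma covering_exists k : k <= K.+1 -> exists phi, covering k phi.
Proof.
elim: k => [|k IH] lt_k; first by exists (fun _ => v).
have [|phi cov] := IH; first exact: ltnW.
have [rt lb] := cov.
have step z : exists f, depth z = k -> local_bijection E M e m f z (phi z) /\
    (z != root -> f (par z) = phi (par z)).
  have [dz|dz] := eqVneq (depth z) k; last by exists phi => E'; rewrite E' eqxx in dz.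
  have [nz mz] := covering_near cov (eq_leq dz).
  have tz' : local_type e m (phi z) by apply: v_type; apply: nearby_le nz; lia.
  have [zr|zr] := eqVneq z root.
    have [f fb] := local_bijection_exists E_asym e_asym (E_type z) tz' (esym mz).
    by exists f.
  have dz' := depth_par zr.
  have lt_p : depth (par z) < k by lia.
  have [fin fout _ _ _] := lb _ lt_p.
  have [_ mp] := covering_near cov (ltnW lt_p).
  have ww : (E (par z) z /\ e (phi (par z)) (phi z)) \/
            (E z (par z) /\ e (phi z) (phi (par z))).
    by case: (tree_E zr) => H; [right|left]; split => //; [case: (fin _ H)|case: (fout _ H)].
  have [f fb fw] := local_bijection_pinned E_asym e_asym (E_type z) tz' (esym mz) ww (esym mp).
  by exists f.
have [f fP] := choice step.
pose phi' x := if depth x <= k then phi x else f (par x) x.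
exists phi'; split; first by rewrite /phi' depth_root.
move=> z; rewrite ltnS leq_eqVlt => /orP[/eqP dz|dz]; last first.
  have -> : phi' z = phi z by rewrite /phi' (ltnW dz).
  apply: local_bijection_ext (lb _ dz) => y zy; rewrite /phi' ifT //.
  have /depth_adj : tree_adj root par z y by apply/tree_adjP; tauto.
  by lia.
have -> : phi' z = phi z by rewrite /phi' dz leqnn.
have [fb fz] := fP z dz.
apply: local_bijection_ext fb => y zy.
have /depth_adj[[zr [-> dd]]|[yr [zE dd]]] : tree_adj root par z y by apply/tree_adjP; tauto.
  by rewrite fz // /phi' ifT //; lia.
by rewrite /phi' ifF -?zE //; lia.
Qed.

End Unfolding.

(** * From a locally bijective map to an isomorphism of balls *)

Section BallIso.
Variables (D : Type) (E : D -> D -> Prop) (M : D -> vmark).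
Variables (V : Type) (e : V -> V -> Prop) (m : V -> vmark).
Variables (phi : D -> V) (c : D) (r : nat).
Let G := RGraph E M c.
Let H := RGraph e m (phi c).
Hypothesis phi_mark : forall x : D, @Defs.within G r c x -> m (phi x) = M x.
Hypothesis phi_loc : forall x : D, @Defs.within G r c x -> local_bijection E M e m phi x (phi x).
Hypothesis phi_inj : forall x y z : D, @Defs.within G r c x -> @Defs.within G r c y ->
  z = y \/ E y z \/ E z y -> phi x = phi z -> x = z.

Lemma within_le s k (x y : gvert G) : s <= k -> Defs.within s x y -> Defs.within k x y.
Proof.
move=> /subnK <-; elim: (k - s)%N => // j IH /IH.
rewrite addSn; move: (j + s)%N => i {IH}.
elim: i x => [|i IH] x; first by move->; exact: Defs.within_refl.
case=> [->|[z [xz zy]]]; first exact: Defs.within_refl.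
by right; exists z; split => //; exact: IH.
Qed.

(** Walks from the centre project and lift along [phi], so ball is mapped onto ball. An edge between
    images lifts to an edge whose far end might lie outside the ball; this is why [phi_inj] reaches
    one step further. *)
Lemma ball_iso : rgraph_iso (Defs.ball r G) (Defs.ball r H).
Proof.
have fwd (k : nat) (x y : D) : @Defs.within G k x y ->
    (forall (s : nat) (z : D), s <= k -> @Defs.within G s x z -> @Defs.within G r c z) ->
    @Defs.within H k (phi x) (phi y).
  elim: k x => [|k IH] x /=; first by move=> ->.
  case=> [->|[z [xz zy]]] near; first by left.
  right; exists (phi z); split.
    have [fin fout _ _ _] := phi_loc (near 0 x isT erefl).
    by case: xz => [/fout|/fin] [? _]; [left|right].
  apply: IH => // s t sk zt; apply: (near s.+1) => //.
  by right; exists z.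
have bwd (k : nat) (y : D) (u : V) : @Defs.within H k (phi y) u ->
    (forall (s : nat) (z : D), s <= k -> @Defs.within G s y z -> @Defs.within G r c z) ->
    exists2 x, @Defs.within G k y x & phi x = u.
  elim: k y => [|k IH] y /=; first by move=> <- _; exists y.
  case=> [<-|[t [yt tu]]] near; first by exists y => //; left.
  have [_ _ _ fsin fsout] := phi_loc (near 0 y isT erefl).
  have [z yz zt] : exists2 z, E y z \/ E z y & phi z = t.
    by case: yt => [/fsout|/fsin] [z yz <-]; exists z => //; [left|right].
  rewrite -zt in tu; have [|x zx xu] := IH z tu.
    by move=> s w sk zw; apply: (near s.+1) => //; right; exists z.
  by exists x => //; right; exists z.
have self (s : nat) (z : D) : s <= r -> @Defs.within G s c z -> @Defs.within G r c z by exact: within_le.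
pose f (x : gvert (Defs.ball r G)) : gvert (Defs.ball r H) :=
  exist _ (phi (sval x)) (fwd r c (sval x) (svalP x) self).
exists f; split.
- rewrite -setTT_bijective; split => //.
    move=> [x xr] [y yr] _ _ /= [pxy]; apply: eq_exist.
    by apply: (phi_inj xr yr) => //; left.
  move=> [u ur] _; have [x xr xu] := bwd r c u ur self.
  by exists (exist _ x xr) => //; apply: eq_exist.
- exact: eq_exist.
- by move=> [x xr] /=; exact: phi_mark.
- move=> [x xr] [y yr] /=; have [fin fout _ _ fsout] := phi_loc xr.
  split; last by move=> /fout[].
  by move=> /fsout[z xz zy]; rewrite (phi_inj yr xr (or_intror (or_introl xz)) (esym zy)).
Qed.

End BallIso.

(** * The limit networks are trees *)

(** The parent of a position on a spine that is entered at 0; the value at 0 itself is a dummy. *)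
Definition toward0 (i : int) : int :=
  match i with Posz k => Posz k.-1 | Negz 0 => 0%Z | Negz k.+1 => Negz k end.

Lemma toward0_pos (i : int) : (0 <= i)%R -> toward0 (i + 1)%R = i.
Proof. by case: i => // k _; rewrite /= addn1. Qed.

Lemma toward0_neg (i : int) : (i < 0)%R -> toward0 i = (i + 1)%R.
Proof. by case: i => // -[|k] _ //=; rewrite NegzE; lia. Qed.

Lemma absz_toward0 (i : int) : i != 0%R -> absz i = (absz (toward0 i)).+1.
Proof. by case: i => [[|k]|[|k]]. Qed.

Lemma toward0_adj (i : int) :
  (0 <= i)%R /\ (i + 1)%R != 0%R /\ toward0 (i + 1)%R = i \/
  (i < 0)%R /\ i != 0%R /\ toward0 i = (i + 1)%R.
Proof.
have [i0|i0] := leP 0%R i; [left|right].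
  by rewrite toward0_pos //; do 2 split => //; lia.
by rewrite toward0_neg //; do 2 split => //; lia.
Qed.

Section DecoratedTree.
Variables (C : Type) (eC : C -> C -> Prop) (mC : C -> vmark) (isD : C -> bool).
Variables (c0 : C) (parC : C -> C) (depthC : C -> nat).
Hypothesis depthC_par : forall c, c <> c0 -> depthC c = (depthC (parC c)).+1.
Hypothesis eC_par : forall c c', eC c c' ->
  (c <> c0 /\ c' = parC c) \/ (c' <> c0 /\ c = parC c').
Hypothesis parC_e : forall c, c <> c0 -> eC c (parC c) \/ eC (parC c) c.
Hypothesis eC_asym : forall c c', eC c c' -> ~ eC c' c.
Hypothesis dec_type : forall c, isD c -> mC c = MTree /\ exists u d,
  [/\ eC u c, eC c d, mC u = MTree & mC d = MTree] /\
  (forall y, eC y c -> y = u) /\ (forall y, eC c y -> y = d).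
Hypothesis undec_type : forall c, ~~ isD c -> local_type eC mC c.

Local Notation dv := (dvert isD).
Local Notation E := (@dedge C eC isD).
Local Notation M := (@dmark C mC isD).

(** The 2 counts the steps from [dec_vert y] through [VRet y] to position 0 of the new spine. *)
Fixpoint ddepth (x : decorated isD) : nat :=
  match x with
  | DBase c => depthC (sval c)
  | DSpine y i => (ddepth y + 2 + absz (sval i))%N
  end.

Definition vdepth (v : dv) : nat :=
  match v with
  | VBase c => depthC c
  | VSpine x i => (ddepth x + 2 + absz i)%N
  | VRet x => (ddepth x).+1
  | VLeaf x => (ddepth x).+2
  end.

Definition vpar (v : dv) : dv :=
  match v with
  | VBase c => VBase isD (parC c)
  | VSpine x i => if i == 0%R then VRet x else VSpine x (toward0 i)
  | VRet x => dec_vert x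
  | VLeaf x => VRet x
  end.

Lemma vdepth_dec x : vdepth (dec_vert x) = ddepth x.
Proof. by case: x. Qed.

Lemma vdepth_par v : v <> VBase isD c0 -> vdepth v = (vdepth (vpar v)).+1.
Proof.
case: v => [c nc|x i _|x _|x _] //=.
- by apply: depthC_par => E; apply: nc; rewrite E.
- have [->|i0] /= := eqVneq i 0%R; first by rewrite addn0 addn2.
  by rewrite (absz_toward0 i0) addnS.
- by rewrite vdepth_dec.
Qed.

Lemma dedgeP a b : E a b ->
  [\/ exists c c', [/\ a = VBase isD c, b = VBase isD c' & eC c c'],
      exists x i, a = VSpine x i /\ b = VSpine x (i + 1)%R,
      exists x, a = dec_vert x /\ b = VRet x |
      (exists x, a = VSpine x 0%R /\ b = VRet x) \/
      (exists x, a = VRet x /\ b = VLeaf x)].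
Proof.
case=> [c c' ?|x i|x|x|x].
- by constructor 1; exists c, c'.
- by constructor 2; exists x, i.
- by constructor 3; exists x.
- by constructor 4; left; exists x.
- by constructor 4; right; exists x.
Qed.

Lemma dec_vert_nret x y : dec_vert x <> VRet y :> dv.
Proof. by case: x. Qed.

Lemma dec_vert_nleaf x y : dec_vert x <> VLeaf y :> dv.
Proof. by case: x. Qed.

Lemma dec_vert_base x c : dec_vert x = VBase isD c ->
  exists Dc : isD c, x = DBase (exist _ c Dc).
Proof. by case: x => [[c' Dc]|//] /= [E]; subst c'; exists Dc. Qed.

Lemma dec_vert_spine x y i : dec_vert x = VSpine y i :> dv ->
  exists i0 : i != 0%R, x = DSpine y (exist _ i i0).
Proof. by case: x => [//|z [j j0]] /= [E E']; subst z j; exists j0. Qed.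

Lemma dedge_asym a b : E a b -> ~ E b a.
Proof.
move=> ab /dedgeP.
case/dedgeP: ab => [[c [c' [-> -> cc']]]|[x [i [-> ->]]]|[x [-> ->]]|[[x [-> ->]]|[x [-> ->]]]].
- case=> [[d [d' [[E1] [E2] dd]]]|[x [i []]]|[x [/esym/dec_vert_base[? ->] //]]|[[x []]|[x []]]] //.
  by subst d d'; exact: eC_asym dd.
- case=> [[d [d' []]]|[y [j [[E1 E2] [E3 E4]]]]|[y [_]]|[[y []]|[y []]]] //.
  by move: E4; rewrite -E2; lia.
- by case=> [[d [d' []]]|[y [j []]]|[y [/esym/dec_vert_nret]]|[[y []]|[y [_ /dec_vert_nleaf]]]].
- by case=> [[d [d' []]]|[y [j []]]|[y [/esym/dec_vert_nret]]|[[y []]|[y []]]].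
by case=> [[d [d' []]]|[y [j []]]|[y [/esym/dec_vert_nleaf]]|[[y []]|[y []]]].
Qed.

Lemma dedge_par a b : E a b ->
  (a <> VBase isD c0 /\ b = vpar a) \/ (b <> VBase isD c0 /\ a = vpar b).
Proof.
case/dedgeP => [[c [c' [-> -> cc']]]|[x [i [-> ->]]]|[x [-> ->]]|[[x [-> ->]]|[x [-> ->]]]].
- by case: (eC_par cc') => -[nc ->]; [left|right]; split => // -[].
- by case: (toward0_adj i) => -[_ [/negbTE i0 iE]]; [right|left]; rewrite /= i0 iE.
- by right.
- by left.
- by right.
Qed.

Lemma vpar_dedge a : a <> VBase isD c0 -> E a (vpar a) \/ E (vpar a) a.
Proof.
case: a => [c nc|x i _|x _|x _] /=.
- have [|cc|cc] := @parC_e c; first by move=> E; apply: nc; rewrite E.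
    by left; constructor.
  by right; constructor.
- have [->|i0] := eqVneq i 0%R; first by left; constructor.
  have [ip|ip] := leP 0%R i; last by left; rewrite toward0_neg //; constructor.
  right; have -> : i = (toward0 i + 1)%R.
    by rewrite -[i in toward0 i](subrK 1%R) toward0_pos; lia.
  have -> : toward0 (toward0 i + 1)%R = toward0 i.
    by congr toward0; rewrite -[i in toward0 i](subrK 1%R) toward0_pos; lia.
  by constructor.
- by right; constructor.
- by right; constructor.
Qed.

Lemma dec_vert_mark x : M (dec_vert x) = MTree.
Proof. by case: x => [[c Dc]|//] /=; case: (dec_type Dc). Qed.

(** Decoration supplies the reticulation child that [dec_type] leaves out; undecorated base vertices
    have their full neighbourhood in the base. *)
Lemma dedge_type v : local_type E M v.
Proof.
case: v => [c|x i|x|x].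
- have [Dc|nD] := boolP (isD c).
    have [Mc [u [d [[uc cd Mu Md] [par ch]]]]] := dec_type Dc.
    rewrite /local_type /= Mc.
    exists (VBase isD u), (VBase isD d), (VRet (DBase (exist _ c Dc))).
    split; first by split; [constructor|constructor|exact: (EDec _ (DBase (exist _ c Dc)))].
    split; first by split.
    split=> y /dedgeP.
      by case=> [[a [a' [-> [<-] ac]]]|[a [i []]]|[a []]|[[a []]|[a []]]] //; rewrite (par _ ac).
    case=> [[a [a' [[<-] -> ac]]]|[a [i []]]|[a [/esym/dec_vert_base[Dc' ->] ->]]|[[a []]|[a []]]] //.
      by left; rewrite (ch _ ac).
    (* A decorated base vertex carries a proof of [isD c]; uniqueness of this proof makes its
       reticulation child unique. *)
    by right; rewrite (bool_irrelevance Dc' Dc).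
  have par y : E y (VBase isD c) -> exists2 a, y = VBase isD a & eC a c.
    by case/dedgeP => [[a [a' [-> [<-] ac]]]|[a [i []]]|[a []]|[[a []]|[a []]]] //; exists a.
  have ch y : E (VBase isD c) y -> exists2 a, y = VBase isD a & eC c a.
    case/dedgeP => [[a [a' [[<-] -> ac]]]|[a [i []]]|[a [/esym/dec_vert_base[Dc]]]|[[a []]|[a []]]] //.
      by exists a'.
    by rewrite Dc in nD.
  have := undec_type nD; rewrite /local_type /=; case: (mC c) => //.
  + move=> [u [d [r [[? ? ?] [[? ? ?] [p h]]]]]].
    exists (VBase isD u), (VBase isD d), (VBase isD r).
    split; first by split; constructor.
    split; first by split.
    split=> y; first by move=> /par[a -> /p ->].
    by move=> /ch[a -> /h[->|->]]; [left|right].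
  + move=> [u [d [r [ud [[? ? ?] [[? ? ?] [p h]]]]]]].
    exists (VBase isD u), (VBase isD d), (VBase isD r).
    split; first by case.
    split; first by split; constructor.
    split; first by split.
    split=> y; last by move=> /ch[a -> /h ->].
    by move=> /par[a -> /p[->|->]]; [left|right].
  move=> [r [? [? [p h]]]]; exists (VBase isD r).
  split; first by constructor.
  split=> //; split=> y; first by move=> /par[a -> /p ->].
  by move=> /ch[a _ /h].
- have par y : E y (VSpine x i) -> y = VSpine x (i - 1)%R.
    case/dedgeP => [[a [a' []]]|[a [j [-> [<- ->]]]]|[a []]|[[a []]|[a []]]] //.
    by rewrite addrK.
  have pre : E (VSpine x (i - 1)%R) (VSpine x i).
    by rewrite -{2}(subrK 1%R i); constructor.
  rewrite /local_type /=; have [i0|i0] := eqVneq i 0%R.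
    exists (VSpine x (i - 1)%R), (VSpine x (i + 1)%R), (VRet x).
    split; first by split => //; [constructor|rewrite i0; constructor].
    split; first by split.
    split=> // y /dedgeP.
    case=> [[a [a' []]]|[a [j [[<- <-] ->]]]|[a [/esym/dec_vert_spine[j0 _] _]]|[[a [[<- _] ->]]|[a []]]] //.
    + by left.
    + by move: j0; rewrite i0 eqxx.
    + by right.
  exists (VSpine x (i - 1)%R), (VSpine x (i + 1)%R), (VRet (DSpine x (exist _ i i0))).
  split; first by split => //; [constructor|exact: (EDec _ (DSpine x (exist _ i i0)))].
  split; first by split.
  split=> // y /dedgeP.
  case=> [[a [a' []]]|[a [j [[<- <-] ->]]]|[a [/esym/dec_vert_spine[j0 ->] ->]]|[[a [[_ E'] _]]|[a []]]] //.
  + by left.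
  + by right; rewrite (bool_irrelevance j0 i0).
  + by case: (elimN eqP i0 E').
- rewrite /local_type /=; exists (dec_vert x), (VSpine x 0%R), (VLeaf x).
  split; first by move=> /dec_vert_spine[i0 _]; move: i0; rewrite eqxx.
  split; first by split; constructor.
  split; first by split => //; exact: dec_vert_mark.
  split=> y /dedgeP.
    by case=> [[a [a' []]]|[a [j []]]|[a [-> [->]]]|[[a [-> [->]]]|[a []]]] //; [left|right].
  by case=> [[a [a' []]]|[a [j []]]|[a [/esym/dec_vert_nret]]|[[a []]|[a [[<-] ->]]]].
rewrite /local_type /=; exists (VRet x); split; first by constructor.
split=> //; split=> y /dedgeP.
  by case=> [[a [a' []]]|[a [j []]]|[a []]|[[a []]|[a [-> [->]]]]].
by case=> [[a [a' []]]|[a [j []]]|[a [/esym/dec_vert_nleaf]]|[[a []]|[a []]]].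
Qed.

End DecoratedTree.

(** * Balls around ordinary vertices *)

Section LocalType.
Variables (n : nat) (V : finType) (e : rel V) (o : V) (lab : 'I_n -> V).
Hypothesis N : simplex_tree_child e o lab.

Local Notation m := (vtype e o lab).
Local Notation exc := (exceptional e o lab).

Lemma vtype_tree v : is_tree e v -> m v = MTree.
Proof.
move=> tv; rewrite /vtype (negbTE (tree_nroot N tv)) (negbTE (tree_nleaf N tv)).
by case rv: (is_ret e v) => //; have := ret_ntree rv; rewrite tv.
Qed.

Lemma vtype_ret v : is_ret e v -> m v = MRet.
Proof.
by move=> rv; rewrite /vtype (negbTE (ret_nroot N rv)) (negbTE (ret_nleaf N rv)) rv.
Qed.

Lemma vtype_leaf v : is_leaf lab v -> m v = MLeaf.
Proof. by move=> lv; rewrite /vtype (negbTE (leaf_nroot N lv)) lv. Qed.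

Lemma not_exceptional v : ~~ exc v ->
  [\/ decorated_tree e v, is_ret e v |
      is_leaf lab v /\ exists2 u, e u v & is_ret e u].
Proof.
rewrite /exceptional !negb_or => /and3P[vo nb nl].
have [lv|nlv] := boolP (is_leaf lab v).
  constructor 3; split => //; move: nl; rewrite /bare_leaf lv /= negbK.
  by case/existsP => u /andP[uv ru]; exists u.
have /orP[tv|rv] := stc_inner_deg N vo nlv; last by constructor 2.
by constructor 1; move: nb; rewrite /branching /decorated_tree tv negbK.
Qed.

(** A neighbour has the wrong mark only if it is the root, or a leaf below a tree vertex; both are
    exceptional. *)
Lemma local_type_good v : ~~ exc v -> (forall u, adj e v u -> ~~ exc u) ->
  local_type e m v.
Proof.
move=> gv gu; have nadj w : adj e v w -> ~~ is_ret e v -> is_leaf lab w -> e v w -> False.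
  move=> vw nr lw evw; have := gu _ vw; rewrite /exceptional !negb_or.
  case/and3P => _ _; rewrite /bare_leaf lw negbK => /existsP[x /andP[xw rx]].
  by rewrite (indeg1_uniq (leaf_deg N lw).1 evw xw) rx in nr.
have up u : e u v -> ~~ is_leaf lab v -> is_tree e u.
  move=> euv nlv; have := gu u; rewrite /adj euv orbT => /(_ isT) /not_exceptional.
  case=> [/andP[]//|ru|[lu _]].
    by rewrite (stc_one_component N ru euv) in nlv.
  by have := edge_nleaf N euv; rewrite lu.
case/not_exceptional: gv => [dv|rv|[lv [u uv ru]]].
- have /andP[tv _] := dv; case/(decoratedP N): dv => r vr rr.
  have nlv := tree_nleaf N tv.
  have nrv : ~~ is_ret e v by apply/negP => rv; have := ret_ntree rv; rewrite tv.
  rewrite /local_type vtype_tree //.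
  have [u uv] : exists u, e u v by apply: indeg_parent; rewrite (tree_deg tv).
  have [d vd td] := stc_tree_child N nlv.
  have rd : r != d.
    by apply: contraTneq td => <-; rewrite negb_or ret_ntree ?(ret_nleaf N).
  have {}td : is_tree e d.
    case/orP: td => // ld; by case: (@nadj d) => //; rewrite /adj vd.
  exists u, d, r; split => //; split.
    by split; [apply: vtype_tree; exact: up|exact: vtype_tree|exact: vtype_ret].
  split=> y.
    by move=> yv; apply: indeg1_uniq (tree_deg tv).1 yv uv.
  move=> vy; have [->|yd] := eqVneq y d; [by left|right].
  apply/eqP/negP => /negP yr.
  apply: (@card_gt2_contra _ [pred w | e v w] r d y) => //; first exact: (tree_deg tv).2.
  by rewrite eq_sym.
- have nlv := ret_nleaf N rv.
  rewrite /local_type vtype_ret //.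
  have /card_gt1P[a [b []]] : 1 < indeg e v by rewrite (ret_deg rv).
  rewrite !inE => av bv ab.
  have [l vl] : exists l, e v l by apply: outdeg_child; rewrite (ret_deg rv).
  exists a, b, l; split; first exact/eqP.
  split=> //; split.
    split; [apply: vtype_tree; exact: up|apply: vtype_tree; exact: up|].
    by apply: vtype_leaf; exact: (stc_one_component N rv vl).
  split=> y; last by move=> vy; apply: outdeg1_uniq (ret_deg rv).2 vy vl.
  move=> yv; have [->|ya] := eqVneq y a; [by left|right].
  apply/eqP/negP => /negP yb.
  apply: (@card_gt2_contra _ [pred w | e w v] a b y) => //; first exact: (ret_deg rv).1.
  by rewrite eq_sym.
rewrite /local_type vtype_leaf //; exists u; split=> //; split; first exact: vtype_ret.
split=> y; first by move=> yv; apply: indeg1_uniq (leaf_deg N lv).1 yv uv.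
by move=> /(edge_nleaf N); rewrite lv.
Qed.

Definition anomalous L u : Prop := exc u \/ short_cycle e L u.

Definition bad_vertex K L v : Prop :=
  exists2 u, nearby e K v u & anomalous L u.

Lemma bad_vertex_le K K' L L' v :
  K <= K' -> L <= L' -> bad_vertex K L v -> bad_vertex K' L' v.
Proof.
move=> KK LL [u vu au]; exists u; first exact: nearby_le vu.
by case: au => [?|[a ca]]; [left|right; exists a; apply: on_short_cycle_le ca].
Qed.

End LocalType.

Section UnfoldingIso.
Variables (D : eqType) (E : D -> D -> Prop) (M : D -> vmark).
Variables (root : D) (par : D -> D) (depth : D -> nat).
Hypothesis depth_root : depth root = 0.
Hypothesis depth_par : forall x, x != root -> depth x = (depth (par x)).+1.
Hypothesis E_tree : forall x y, E x y -> tree_adj root par x y.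
Hypothesis tree_E : forall x, x != root -> E x (par x) \/ E (par x) x.
Hypothesis E_asym : forall x y, E x y -> ~ E y x.
Hypothesis E_type : forall x, local_type E M x.

Variables (n : nat) (V : finType) (e : rel V) (o : V) (lab : 'I_n -> V).
Hypothesis N : simplex_tree_child e o lab.

Let m := vtype e o lab.

Lemma within_depth r (c x : D) :
  @Defs.within (RGraph E M c) r c x -> depth x <= depth c + r.
Proof.
suff H (y : D) : @Defs.within (RGraph E M c) r y x -> depth x <= depth y + r by exact: H.
elim: r y => [|r IH] y /=; first by move=> ->; rewrite addn0.
case=> [->|[z [yz /IH zx]]]; first exact: leq_addr.
have /(depth_adj depth_par) : tree_adj root par y z.
  by apply: (tree_adjP E_tree tree_E _ _).2.
by lia.
Qed.

(** The balls considered have depth at most [R]. Injectivity is needed one step further, which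
    excludes closed walks of [2 * R.+1] steps; the local types at depth [R.+1] involve vertices at
    distance up to [R + 2] from [v]. The centre [c] may differ from the root, as required for the
    limit rooted at a leaf. *)
Lemma unfolding_iso R v : m v = M root -> ~ bad_vertex e o lab (R + 3) (2 * R.+1) v ->
  exists phi : D -> V, [/\ phi root = v, local_bijection E M e m phi root v &
    forall c r, (depth c + r <= R)%N ->
      rgraph_iso (Defs.ball r (RGraph E M c))
                 (Defs.ball r (RGraph (fun x y => e x y) m (phi c)))].
Proof.
move=> mv good.
have ty u : nearby e R.+1 v u -> local_type e m u.
  move=> vu; apply: (local_type_good N) => [|w uw]; apply/negP => ex; apply: good.
    by exists u; [apply: nearby_le vu; lia|left].
  exists w; last by left.
  by apply: nearby_le (nearby_trans vu (nearby_adj uw)); lia.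
have [phi cov] := covering_exists depth_root depth_par E_tree tree_E E_asym E_type N
  mv ty (leqnn R.+2).
have [rt lb] := cov.
have near x : depth x <= R.+2 -> nearby e (depth x) v (phi x) /\ m (phi x) = M x.
  by move=> dx; exact: (covering_near depth_root depth_par tree_E mv cov dx).
have inj x y : depth x <= R.+1 -> depth y <= R.+1 -> phi x = phi y -> x = y.
  apply: (tree_map_inj depth_root depth_par N).
  - move=> z w dz; move/(tree_adjP E_tree tree_E _ _).1 => zw; have [fin fout _ _ _] := lb z dz.
    by rewrite /adj; case: zw => [/fout|/fin] [->]; rewrite ?orbT.
  - move=> z w w' dz; move/(tree_adjP E_tree tree_E _ _).1 => zw.
    move/(tree_adjP E_tree tree_E _ _).1 => zw'.
    by have [_ _ finj _ _] := lb z dz; apply: finj; tauto.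
  - move=> z dz sc; apply: good; exists (phi z); last by right.
    by have [nz _] := near z (leqW dz); apply: nearby_le nz; lia.
exists phi; split => //; first by have := lb root; rewrite depth_root rt; apply.
move=> c r cr; apply: ball_iso.
- move=> x xr; have dx := within_depth xr; have le : depth x <= R.+2 by lia.
  exact: (near x le).2.
- by move=> x xr; have dx := within_depth xr; apply: lb; lia.
move=> x y z xr yr yz; have dx := within_depth xr; have dy := within_depth yr; apply: inj; first by lia.
case: yz => [->|yz]; first by lia.
have /(depth_adj depth_par) : tree_adj root par y z.
  by apply: (tree_adjP E_tree tree_E _ _).2.
by lia.
Qed.

End UnfoldingIso.

Section DecoratedIso.
Variables (C : Type) (eC : C -> C -> Prop) (mC : C -> vmark) (isD : C -> bool).
Variables (c0 : C) (parC : C -> C) (depthC : C -> nat).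
Hypothesis depthC0 : depthC c0 = 0.
Hypothesis depthC_par : forall c, c <> c0 -> depthC c = (depthC (parC c)).+1.
Hypothesis eC_par : forall c c', eC c c' ->
  (c <> c0 /\ c' = parC c) \/ (c' <> c0 /\ c = parC c').
Hypothesis parC_e : forall c, c <> c0 -> eC c (parC c) \/ eC (parC c) c.
Hypothesis eC_asym : forall c c', eC c c' -> ~ eC c' c.
Hypothesis dec_type : forall c, isD c -> mC c = MTree /\ exists u d,
  [/\ eC u c, eC c d, mC u = MTree & mC d = MTree] /\
  (forall y, eC y c -> y = u) /\ (forall y, eC c y -> y = d).
Hypothesis undec_type : forall c, ~~ isD c -> local_type eC mC c.

Variables (n : nat) (V : finType) (e : rel V) (o : V) (lab : 'I_n -> V).
Hypothesis N : simplex_tree_child e o lab.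

Local Notation m := (vtype e o lab).

(** The clause on the children of [c0] serves to identify the image of [RLeaf0] when the root is
    [RRet0]. *)
Lemma decorate_iso R v : m v = mC c0 -> ~ bad_vertex e o lab (R + 3) (2 * R.+1) v ->
  exists phi : C -> V, [/\ phi c0 = v,
    forall c, eC c0 c -> e v (phi c) &
    forall c r, (depthC c + r <= R)%N ->
      rgraph_iso (Defs.ball r (decorate eC mC isD c))
                 (Defs.ball r (RGraph (fun x y => e x y) m (phi c)))].
Proof.
move=> mv good; pose T : eqType := {classic dvert isD}.
have eqT (x y : T) : x != y <-> x <> y by split => /eqP.
have h1 : forall x : T, x != VBase isD c0 :> T ->
    vdepth depthC x = (vdepth depthC (vpar parC x)).+1.
  by move=> x /eqT; exact: (vdepth_par depthC_par).
have h2 (x y : T) : dedge eC x y -> tree_adj (VBase isD c0 : T) (@vpar C isD parC) x y.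
  by case/(dedge_par eC_par) => -[/eqT nx ->]; rewrite /tree_adj nx eqxx ?orbT.
have h3 (x : T) : x != VBase isD c0 :> T ->
    dedge eC x (vpar parC x) \/ dedge eC (vpar parC x) x.
  by move=> /eqT; exact: (vpar_dedge parC_e).
have h4 : forall x y : T, dedge eC x y -> ~ dedge eC y x by move=> x y; exact: (dedge_asym eC_asym).
have h5 : forall x : T, local_type (@dedge C eC isD) (@dmark C mC isD) x
  by exact: (dedge_type dec_type undec_type).
have [phi [p0 [_ fout _ _ _] iso]] :=
  unfolding_iso (depthC0 : vdepth depthC (VBase isD c0) = 0) h1 h2 h3 h4 h5 N mv good.
exists (fun c => phi (VBase isD c)); split => //.
  by move=> c cc; case: (fout (VBase isD c)) => //; constructor.
by move=> c r cr; exact: iso.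
Qed.

End DecoratedIso.

Lemma rgraph_iso_sym G H : rgraph_iso G H -> rgraph_iso H G.
Proof.
move=> [f [[g fK gK] fr fm fe]]; exists g; split; first by exists f.
- by rewrite -fr fK.
- by move=> x; rewrite -[x in RHS]gK fm.
- by move=> x y; rewrite -{2}[x]gK -{2}[y]gK; split; move/fe.
Qed.

Lemma rgraph_iso_trans G H K : rgraph_iso G H -> rgraph_iso H K -> rgraph_iso G K.
Proof.
move=> [f [fb fr fm fe]] [g [gb gr gm ge]]; exists (g \o f); split => /=.
- exact: bij_comp.
- by rewrite fr.
- by move=> x; rewrite gm.
- by move=> x y; split; [move=> /ge/fe|move=> /fe/ge].
Qed.

(** * The base of the limit around a reticulation, as a tree rooted at [RRet0] *)

Definition rbase_par (c : rbase) : rbase :=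
  match c with
  | RSpine b i => if i == 0%R then RRet0 else RSpine b (toward0 i)
  | _ => RRet0
  end.

Definition rbase_depth (c : rbase) : nat :=
  match c with RSpine _ i => (absz i).+1 | RRet0 => 0 | RLeaf0 => 1 end.

Lemma rbase_depth_par c : c <> RRet0 -> rbase_depth c = (rbase_depth (rbase_par c)).+1.
Proof.
case: c => [b i _|//|//] /=; have [->//|i0] := eqVneq i 0%R.
by rewrite /= -absz_toward0.
Qed.

Lemma rbase_edge_par c c' : rbase_edge c c' ->
  (c <> RRet0 /\ c' = rbase_par c) \/ (c' <> RRet0 /\ c = rbase_par c').
Proof.
case=> [b i|b|]; [|by left|by right].
by case: (toward0_adj i) => -[_ [/negbTE i0 iE]]; [right|left]; rewrite /= i0 iE.
Qed.

Lemma rbase_par_edge c : c <> RRet0 -> rbase_edge c (rbase_par c) \/ rbase_edge (rbase_par c) c.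
Proof.
case: c => [b i _|//|_] /=; last by right; constructor.
have [->|i0] := eqVneq i 0%R; first by left; constructor.
have [ip|ip] := leP 0%R i; last by left; rewrite toward0_neg //; constructor.
right; have E : (toward0 i + 1)%R = i.
  by rewrite -[i in toward0 i](subrK 1%R) toward0_pos ?subrK //; lia.
by rewrite -{2}E; constructor.
Qed.

Lemma rbase_edge_inv c c' : rbase_edge c c' ->
  [\/ exists b i, c = RSpine b i /\ c' = RSpine b (i + 1)%R,
      exists b, c = RSpine b 0%R /\ c' = RRet0 |
      c = RRet0 /\ c' = RLeaf0].
Proof.
case=> [b i|b|]; [constructor 1|constructor 2|by constructor 3].
  by exists b, i.
by exists b.
Qed.

Lemma rbase_edge_asym c c' : rbase_edge c c' -> ~ rbase_edge c' c.
Proof.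
move=> cc /rbase_edge_inv; case/rbase_edge_inv: cc => [[b [i [-> ->]]]|[b [-> ->]]|[-> ->]].
- by case=> [[b' [j [[_ E] [_ E']]]]|[b' []]|[]] //; move: E'; rewrite -E; lia.
- by case=> [[b' [j []]]|[b' []]|[]].
- by case=> [[b' [j []]]|[b' []]|[]].
Qed.

Lemma rbase_spine_in b i y : rbase_edge y (RSpine b i) -> y = RSpine b (i - 1)%R.
Proof.
case/rbase_edge_inv => [[b' [j [-> [-> ->]]]]|[b' []]|[]] //.
by rewrite addrK.
Qed.

Lemma rbase_spine_pre b i : rbase_edge (RSpine b (i - 1)%R) (RSpine b i).
Proof. by rewrite -{2}(subrK 1%R i); constructor. Qed.

Lemma rbase_dec_type c : rbase_dec c -> rbase_mark c = MTree /\ exists u d,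
  [/\ rbase_edge u c, rbase_edge c d, rbase_mark u = MTree & rbase_mark d = MTree] /\
  (forall y, rbase_edge y c -> y = u) /\ (forall y, rbase_edge c y -> y = d).
Proof.
case: c => [b i /= i0|//|//]; split=> //.
exists (RSpine b (i - 1)%R), (RSpine b (i + 1)%R); split.
  by split => //; [exact: rbase_spine_pre|constructor].
split=> y; first exact: rbase_spine_in.
case/rbase_edge_inv => [[b' [j [[<- <-] ->]]]|[b' [[_ E] _]]|[]] //.
by rewrite E eqxx in i0.
Qed.

Lemma rbase_undec_type c : ~~ rbase_dec c -> local_type rbase_edge rbase_mark c.
Proof.
case: c => [b i /=|_|_]; rewrite /local_type /=.
- rewrite negbK => /eqP ->.
  exists (RSpine b (0 - 1)%R), (RSpine b (0 + 1)%R), RRet0; split.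
    by split; [exact: rbase_spine_pre|constructor|constructor].
  split; first by split.
  split=> y; first exact: rbase_spine_in.
  by case/rbase_edge_inv => [[b' [j [[<- <-] ->]]]|[b' [_ ->]]|[]] //; [left|right].
- exists (RSpine false 0%R), (RSpine true 0%R), RLeaf0; split; first by [].
  split; first by split; constructor.
  split; first by split.
  split=> y.
    by case/rbase_edge_inv => [[b' [j []]]|[b' [-> _]]|[]] //; case: b'; [right|left].
  by case/rbase_edge_inv => [[b' [j []]]|[b' []]|[]].
exists RRet0; split; first by constructor.
split; first by [].
split=> y.
  by case/rbase_edge_inv => [[b' [j []]]|[b' []]|[]].
by case/rbase_edge_inv => [[b' [j []]]|[b' []]|[]].
Qed.

(** * Balls of the three limits inside a network *)

Section LimitBalls.
Variables (n : nat) (V : finType) (e : rel V) (o : V) (lab : 'I_n -> V).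
Hypothesis N : simplex_tree_child e o lab.
Variable (r : nat) (v : V).

Local Notation m := (vtype e o lab).
Local Notation rooted v := (RGraph (fun x y => e x y) m v).

Hypothesis good : ~ bad_vertex e o lab (r + 5) (2 * r.+2) v.

Lemma Lhat_iso : m v = MTree -> rgraph_iso (Defs.ball r Lhat) (Defs.ball r (rooted v)).
Proof.
move=> mv.
have [] := @decorate_iso int (fun i j => j = (i + 1)%R) (fun _ => MTree) (fun _ => true)
  0%R toward0 absz erefl _ _ _ _ _ _ _ _ _ _ _ N r v mv.
- by move=> c /eqP; exact: absz_toward0.
- by move=> c _ ->; case: (toward0_adj c) => -[_ [/eqP c0 cE]]; [right|left].
- move=> c /eqP c0; have := toward0_adj c; have := toward0_adj (c - 1)%R.
  by rewrite subrK; case=> -[? [_ tE]]; case=> -[? [? tE']]; rewrite ?tE ?tE'; lia.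
- by move=> c c' -> ; lia.
- move=> c _; split => //; exists (c - 1)%R, (c + 1)%R; split.
    by rewrite subrK.
  by split => y; lia.
- by [].
- by move: good; apply: contra_not; apply: bad_vertex_le; lia.
by move=> phi [<- _ iso]; exact: iso.
Qed.

Lemma Rhat_iso : m v = MRet -> rgraph_iso (Defs.ball r Rhat) (Defs.ball r (rooted v)).
Proof.
move=> mv.
have good' : ~ bad_vertex e o lab (r + 3) (2 * r.+1) v.
  by move: good; apply: contra_not; apply: bad_vertex_le; lia.
have [phi [<- _ iso]] := decorate_iso (c0 := RRet0) (erefl : rbase_depth RRet0 = 0)
  rbase_depth_par rbase_edge_par rbase_par_edge rbase_edge_asym rbase_dec_type
  rbase_undec_type N mv good'.
exact: iso.
Qed.

(** The tree is unfolded from the reticulation [u] above the leaf, with radius [r.+1]. This requires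
    goodness up to [r + 4] around [u], hence [r + 5] around [v], and cycle length [2 * r.+2]; these
    are the parameters of [good]. *)
Lemma Nhat_lf_iso : m v = MLeaf -> rgraph_iso (Defs.ball r Nhat_lf) (Defs.ball r (rooted v)).
Proof.
move=> mv.
have nev : ~~ exceptional e o lab v.
  by apply/negP => ev; apply: good; exists v; [exact: nearby_refl|left].
have [u uv ru] : exists2 u, e u v & is_ret e u.
  case/(not_exceptional N): nev => [/andP[/(vtype_tree N)]|/(vtype_ret N)|[_ //]];
  by rewrite mv.
have good' : ~ bad_vertex e o lab (r.+1 + 3) (2 * r.+2) u.
  move=> [w uw aw]; apply: good; exists w => //.
  have vu : adj e v u by rewrite /adj uv orbT.
  by apply: nearby_le (nearby_trans (nearby_adj vu) uw); lia.
have [phi [_ leafE iso]] := decorate_iso (c0 := RRet0) (erefl : rbase_depth RRet0 = 0)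
  rbase_depth_par rbase_edge_par rbase_par_edge rbase_edge_asym rbase_dec_type
  rbase_undec_type N (vtype_ret N ru) good'.
have <- : phi RLeaf0 = v.
  by apply: (outdeg1_uniq (ret_deg ru).2) uv; apply: leafE; constructor.
exact: iso.
Qed.

End LimitBalls.

(** * Averages *)

Definition bad_set r n (N : prenet n) : {set nvert N} :=
  [set v | `[< bad_vertex (@nedge n N) (nroot N) (@nlab n N) (r + 5) (2 * r.+2) v >]]%SET.

(** Double counting: a bad vertex lies in the ball of radius [r + 5] around an anomalous one, and
    such a ball has at most [4 ^ (r + 5)] vertices. *)
Lemma card_bad_set r n (N : prenet n) : is_network N ->
  #|bad_set r N| <= 4 ^ (r + 5) * (2 * (n - reps N) + #|bad_cycle (2 * r.+2) N|).
Proof.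
move=> NN; pose A (u : nvert N) :=
  exceptional (@nedge n N) (nroot N) (@nlab n N) u || (u \in bad_cycle (2 * r.+2) N).
apply: (@leq_trans (\sum_(u | A u) \sum_v nearby (@nedge n N) (r + 5) u v)).
  rewrite exchange_big /= -(sum_pred (mem (bad_set r N))).
  apply: leq_sum => v _ /=; case: (boolP (v \in bad_set r N)) => //.
  rewrite inE => /asboolP[u vu au].
  have Au : A u.
    by rewrite /A inE; case: au => [->//|sc]; rewrite orbC asboolT.
  by rewrite (bigD1 u) //= nearby_sym vu.
apply: (@leq_trans (\sum_(u | A u) 4 ^ (r + 5))).
  by apply: leq_sum => u _; rewrite sum_pred; apply/card_nearby/(deg_le3 NN).
rewrite sum_nat_const mulnC leq_mul2l -(card_exceptional NN); apply/orP; right.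
rewrite -(sum_pred A) -(sum_pred (exceptional _ _ _)) -(sum_pred (mem (bad_cycle _ _))).
rewrite -big_split /=; apply: leq_sum => u _; rewrite /A.
by case: exceptional => //; case: (u \in _).
Qed.

(** A common error term for all deviations; the successor absorbs the 1 in the number [n + k - 1] of
    tree vertices. *)
Definition disorder L n (N : prenet n) : nat := (n - reps N + #|bad_cycle L N|).+1.

Lemma reps_le n (N : prenet n) : is_network N -> reps N <= n.
Proof. by move=> NN; have := card_ret_leaf NN; rewrite /reps; lia. Qed.

Lemma card_bad_cycle L n (N : prenet n) : is_network N -> #|bad_cycle L N| <= 2 * reps N.
Proof.
move=> NN; have <- : #|decorated_tree (@nedge n N)| = 2 * reps N := card_decorated NN.
apply: subset_leq_card; apply/fintype.subsetP => x.
rewrite inE => /asboolP[a [w [p [[rw xw _ _] _]]]].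
have dx : decorated_tree (@nedge n N) x by apply/(decoratedP NN); exists w.
exact: dx.
Qed.

(** Divided by [a * n], this bounds the normalised mean by [c * a.+1 / n + 6 / a], where [n] is to
    grow before [a]. The 6 is three times the 2 of [sum_bare_le], because the cycles contribute two
    more copies of the mean of [n - reps N]. *)
Lemma sum_disorder_le L : exists c, forall a n, 0 < n ->
  a * (\sum_(N in networks n) disorder L N) <= #|networks n| * (c * a * a.+1 + 6 * n).
Proof.
pose c1 := 4 ^ L; pose c2 := 4 ^ (L + 2); exists (2 * c2 + c1 + 4) => a n n0.
set T := #|networks n|.
set SJ := \sum_(N in networks n) (n - reps N).
set SB := \sum_(N in networks n) #|bad_cycle L N|.
have -> : \sum_(N in networks n) disorder L N = T + SJ + SB.
  rewrite /T -sum1_card -!big_split /=; apply: eq_bigr => N _.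
  by rewrite /disorder -addnA add1n.
(* Either [n - reps N <= a.+1], or [a] is at most its predecessor and the product in [sum_bare_le]
   takes over. *)
have hJ : a * SJ <= T * (a * a.+1) + T * (2 * n).
  apply: leq_trans (leq_add (leqnn _) (sum_bare_le n)).
  rewrite /SJ big_distrr /T -sum_nat_const -big_split /=; apply: leq_sum => N _.
  set j := n - reps N; have [le|lt] := leqP j a.+1.
    by apply: leq_trans (leq_addr _ _); rewrite leq_mul2l le orbT.
  apply: leq_trans (leq_addl _ _); rewrite mulnC leq_mul2l; apply/orP; right.
  by lia.
have hB : 2 * n * SB <= T * (4 * n * c2) + 2 * n * (2 * SJ + c1 * T).
  apply: leq_trans (leq_add (sum_cycle_le n L) (leqnn _)).
  have -> : 2 * SJ + c1 * T = \sum_(N in networks n) (2 * (n - reps N) + c1).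
    by rewrite big_split /= -big_distrr /= sum_nat_const; congr addn; exact: mulnC.
  rewrite /SB !big_distrr -big_split /=; apply: leq_sum => N /networks_network NN.
  have := card_bad_cycle L NN; have := reps_le NN; rewrite -/c1.
  set b := #|bad_cycle L N|; set k := reps N => kn bk.
  (* The first part is the factor in [sum_cycle_le]; the second gets multiplied by [b], which is at
     most [2 * n]. *)
  have e : 2 * n <= (2 * k - c1) + (2 * (n - k) + c1) by lia.
  apply: leq_trans (leq_mul e (leqnn b)) _.
  rewrite mulnDl leq_add //; first by rewrite mulnC.
  by rewrite mulnC leq_mul //; lia.
have {}hB : SB <= T * (2 * c2 + c1) + 2 * SJ.
  rewrite -(leq_pmul2l (_ : 0 < 2 * n)) ?muln_gt0 //.
  by apply: leq_trans hB _; lia.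
have h : a * SB <= a * (T * (2 * c2 + c1)) + 2 * (a * SJ).
  by apply: leq_trans (leq_mul (leqnn a) hB) _; lia.
have aa : a <= a * a.+1 by rewrite leq_pmulr.
have h1 : a * T <= T * (a * a.+1) by rewrite mulnC leq_mul2l aa orbT.
have h2 : a * (T * (2 * c2 + c1)) <= (2 * c2 + c1) * (T * (a * a.+1)).
  by rewrite mulnA [_ * (2 * c2 + c1)]mulnC leq_mul2l h1 orbT.
have -> : T * ((2 * c2 + c1 + 4) * a * a.+1 + 6 * n) =
  (2 * c2 + c1 + 4) * (T * (a * a.+1)) + 6 * (T * n) by lia.
move: h h1 h2 hJ; set X := T * (a * a.+1).
rewrite !mulnDr; move: (a * SB) (a * SJ) (a * T) (a * (T * (2 * c2)) ) => *.
by lia.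
Qed.

Import numFieldNormedType.Exports.

Local Open Scope ring_scope.
Local Open Scope classical_set_scope.

Section Means.
Variables (R : realType) (n : nat).
Hypothesis n0 : (0 < n)%N.

Lemma card_networks_pos : 0 < #|networks n|%:R :> R.
Proof. by rewrite ltr0n; case: n n0 => // k _; exact: card_networks_gt0. Qed.

Lemma le_net_mean (f g : prenet n -> R) :
  (forall N, is_network N -> f N <= g N) -> net_mean f <= net_mean g.
Proof.
move=> fg; rewrite ler_pM2r ?invr_gt0 ?card_networks_pos //.
by apply: ler_sum => N /networks_network /fg.
Qed.

Lemma net_mean_dist (f : prenet n -> R) c :
  `|net_mean f - c| <= net_mean (fun N => `|f N - c|).
Proof.
have -> : net_mean f - c = net_mean (fun N => f N - c).
  rewrite /net_mean sumrB sumr_const mulrBl -[c *+ _]mulr_natr mulfK //.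
  by rewrite gt_eqF ?card_networks_pos.
rewrite normrM [X in _ * X]ger0_norm ?invr_ge0 ?ler0n //.
by rewrite ler_wpM2r ?invr_ge0 ?ler0n // ler_norm_sum.
Qed.

Lemma net_meanZ (f : prenet n -> R) c : net_mean (fun N => c * f N) = c * net_mean f.
Proof. by rewrite /net_mean -mulr_sumr mulrA. Qed.

Lemma net_prob_markov (f : prenet n -> R) eps : 0 < eps ->
  net_prob R [set N : prenet n | eps <= `|f N|] <= eps^-1 * net_mean (fun N => `|f N|).
Proof.
move=> e0; rewrite -net_meanZ; apply: le_net_mean => N _.
rewrite indicE; case: (boolP (N \in _)) => [|_]; last first.
  by rewrite mulr_ge0 ?invr_ge0 // ltW.
rewrite inE /= => le; rewrite mulrC -ler_pdivrMr ?invr_gt0 // invrK mul1r; exact: le.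
Qed.

End Means.

Section Vanishing.
Variables (R : realType) (L : nat).

Definition mean_disorder (n : nat) : R :=
  net_mean (fun N : prenet n => (disorder L N)%:R) / n%:R.

Lemma mean_disorder_cvg0 : mean_disorder n @[n --> \oo] --> (0 : R).
Proof.
have [c H] := sum_disorder_le L.
apply/cvgrPdist_le => eps e0.
(* This [a] makes [6 / a] at most [eps / 2]; with [a] fixed, large [n] takes care of the other
   half. *)
pose a := (Num.truncn (12 / eps)).+1.
have a0 : (0 : R) < a%:R by rewrite ltr0n.
have ae : 6 / a%:R <= eps / 2.
  rewrite ler_pdivrMr // mulrC -ler_pdivrMr; last by rewrite divr_gt0.
  have := truncnS_gt (12 / eps); rewrite -/a => /ltW; apply: le_trans.
  by rewrite invf_div mulrA [6 * 2]mulrC -natrM.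
near=> n.
have n0 : (0 < n)%N by near: n; exists 1%N.
have n0' : (0 : R) < n%:R by rewrite ltr0n.
have nb : (c * a.+1)%:R / n%:R <= eps / 2.
  rewrite ler_pdivrMr // mulrC -ler_pdivrMr; last by rewrite divr_gt0.
  apply: (@le_trans _ _ (Num.truncn ((c * a.+1)%:R / (eps / 2))).+1%:R).
    exact/ltW/truncnS_gt.
  by rewrite ler_nat; near: n; exists (Num.truncn ((c * a.+1)%:R / (eps / 2))).+1.
have T0 := card_networks_pos R n0.
have md0 : 0 <= mean_disorder n.
  by rewrite /mean_disorder /net_mean !divr_ge0 ?ler0n // sumr_ge0.
rewrite sub0r normrN ger0_norm //.
suff le : mean_disorder n <= (c * a.+1)%:R / n%:R + 6 / a%:R by lra.
rewrite /mean_disorder /net_mean ler_pdivrMr // ler_pdivrMr //.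
rewrite -natr_sum -(ler_pM2l a0) -natrM.
apply: le_trans (_ : (#|networks n| * (c * a * a.+1 + 6 * n))%:R <= _).
  by rewrite ler_nat; exact: H.
rewrite !natrM !natrD !natrM le_eqVlt; apply/orP; left; apply/eqP; field.
by rewrite !gt_eqF.
Unshelve. all: by end_near.
Qed.

Lemma cvg_disorder (u : nat -> R) l C :
  (forall n, (0 < n)%N -> `|u n - l| <= C * mean_disorder n) -> u n @[n --> \oo] --> l.
Proof.
move=> ul; apply/subr_cvg0/norm_cvg0P.
apply: (@squeeze_cvgr _ _ _ _ (fun=> 0) (fun n => C * mean_disorder n)).
- near=> n; rewrite normr_ge0 /=; apply: ul; near: n; by exists 1%N.
- exact: cvg_cst.
by rewrite -[X in _ --> X](mulr0 C); apply: cvgMr; exact: mean_disorder_cvg0.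
Unshelve. all: by end_near.
Qed.

End Vanishing.

Section Deviation.
Variables (R : realType) (n : nat).
Hypothesis n0 : (0 < n)%N.

Lemma net_mean_disorder L (f : prenet n -> R) c C :
  (forall N, is_network N -> `|f N - c| <= C * ((disorder L N)%:R / n%:R)) ->
  net_mean (fun N => `|f N - c|) <= C * mean_disorder R L n.
Proof.
move=> fc; apply: le_trans (le_net_mean n0 fc) _.
by rewrite net_meanZ /mean_disorder /net_mean -mulr_suml mulrAC.
Qed.

Section Network.
Variable N : prenet n.
Hypothesis NN : is_network N.

Lemma ntypeE (v : nvert N) :
  [/\ `[< ntype v = MTree >] = is_tree (@nedge n N) v,
      `[< ntype v = MRet >] = is_ret (@nedge n N) v &
      `[< ntype v = MLeaf >] = is_leaf (@nlab n N) v].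
Proof.
have := vertex_types NN v; rewrite /ntype /vtype.
case: eqP => [|_] /=; case: is_leaf; case: is_ret; case: is_tree => //= _;
  by split; apply/asboolP.
Qed.

Lemma card_vert_real : #|nvert N|%:R = 2 * (n%:R + (reps N)%:R) :> R.
Proof. by rewrite (card_vert NN) natrD !natrM mulrDr. Qed.

Lemma card_tree_real : #|is_tree (@nedge n N)|%:R = n%:R + (reps N)%:R - 1 :> R.
Proof.
by have := congr1 (fun k => k%:R : R) (card_tree NN); rewrite -natr1 natrD => <-; rewrite addrK.
Qed.

(** A network has at least [n] vertices, so dividing by their number gains at least the factor
    [1 / n]. *)
Lemma deviation_le L C (x b : R) : 0 <= C ->
  `|x| <= b -> b <= C * (disorder L N)%:R ->
  `|x / #|nvert N|%:R| <= C * ((disorder L N)%:R / n%:R).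
Proof.
move=> C0 xb bD; rewrite card_vert_real normrM normfV mulrA.
have n0' : (0 : R) < n%:R by rewrite ltr0n.
have k0 : (0 : R) <= (reps N)%:R by rewrite ler0n.
rewrite (@ger0_norm _ (2 * _)); last by lra.
apply: ler_pM; rewrite ?normr_ge0 ?invr_ge0; [by []|lra|exact: le_trans bD|].
by rewrite lef_pV2 ?posrE; lra.
Qed.

Lemma sub_repsE : (n - reps N)%:R = n%:R - (reps N)%:R :> R.
Proof. by rewrite natrB // reps_le. Qed.

Lemma disorderE L :
  (disorder L N)%:R = n%:R - (reps N)%:R + #|bad_cycle L N|%:R + 1 :> R.
Proof. by rewrite /disorder -natr1 natrD sub_repsE. Qed.

Lemma proportion_deviation L (t : vmark) (x c : R) :
  #|[pred v : nvert N | `[< ntype v = t >]]|%:R = x ->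
  `|x - c * #|nvert N|%:R| <= (disorder L N)%:R ->
  `|type_proportion R t N - c| <= 1 * ((disorder L N)%:R / n%:R).
Proof.
move=> <- le; set X := (X in X - _) in le.
have V0 : #|nvert N|%:R != 0 :> R.
  by rewrite pnatr_eq0 (card_vert NN); lia.
have -> : type_proportion R t N - c = (X - c * #|nvert N|%:R) / #|nvert N|%:R.
  by rewrite mulrBl mulfK.
by apply: deviation_le le _; rewrite ?mul1r.
Qed.

Lemma reps_bounds : (0 <= (reps N)%:R :> R) && ((reps N)%:R <= n%:R :> R).
Proof. by rewrite ler0n ler_nat reps_le. Qed.

Lemma tree_deviation L :
  `|type_proportion R MTree N - 2^-1| <= 1 * ((disorder L N)%:R / n%:R).
Proof.
apply: (@proportion_deviation L MTree (n%:R + (reps N)%:R - 1)).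
  rewrite -card_tree_real; congr (_%:R); apply: eq_card => v.
  by rewrite inE /=; case: (ntypeE v).
rewrite card_vert_real disorderE; have /andP[k0 kn] := reps_bounds.
have b0 : (0 : R) <= #|bad_cycle L N|%:R by rewrite ler0n.
by rewrite ler_norml; apply/andP; split; lra.
Qed.

Lemma ret_deviation L :
  `|type_proportion R MRet N - 4^-1| <= 1 * ((disorder L N)%:R / n%:R).
Proof.
apply: (@proportion_deviation L MRet (reps N)%:R).
  congr (_%:R); apply: eq_card => v.
  by rewrite inE /=; case: (ntypeE v).
rewrite card_vert_real disorderE; have /andP[k0 kn] := reps_bounds.
have b0 : (0 : R) <= #|bad_cycle L N|%:R by rewrite ler0n.
by rewrite ler_norml; apply/andP; split; lra.
Qed.

Lemma leaf_deviation L :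
  `|type_proportion R MLeaf N - 4^-1| <= 1 * ((disorder L N)%:R / n%:R).
Proof.
apply: (@proportion_deviation L MLeaf n%:R).
  rewrite -[in RHS](card_leaf NN); congr (_%:R); apply: eq_card => v.
  by rewrite inE /=; case: (ntypeE v).
rewrite card_vert_real disorderE; have /andP[k0 kn] := reps_bounds.
have b0 : (0 : R) <= #|bad_cycle L N|%:R by rewrite ler0n.
by rewrite ler_norml; apply/andP; split; lra.
Qed.

Lemma good_vertex_ball r G (v : nvert N) : v \notin bad_set r N ->
  `[< rgraph_iso (Defs.ball r (rooted_net v)) G >] =
    [|| is_tree (@nedge n N) v && `[< rgraph_iso (Defs.ball r Lhat) G >],
        is_ret (@nedge n N) v && `[< rgraph_iso (Defs.ball r Rhat) G >] |
        is_leaf (@nlab n N) v && `[< rgraph_iso (Defs.ball r Nhat_lf) G >]].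
Proof.
rewrite inE => /asboolP good.
have swap H : rgraph_iso (Defs.ball r H) (Defs.ball r (rooted_net v)) ->
    `[< rgraph_iso (Defs.ball r (rooted_net v)) G >] = `[< rgraph_iso (Defs.ball r H) G >].
  move=> i; apply/asboolP/asboolP; first exact: rgraph_iso_trans.
  by apply: rgraph_iso_trans; exact: rgraph_iso_sym.
have vo : (v == nroot N) = false.
  by apply/negP => vo; apply: good; exists v; [exact: nearby_refl|left; rewrite /exceptional vo].
have := vertex_types NN v; rewrite vo.
have [lv|_] := boolP (is_leaf _ v); have [tv|_] := boolP (is_tree _ v);
  have [rv|_] := boolP (is_ret _ v) => //= _.
- by rewrite (swap _ (Nhat_lf_iso NN good (vtype_leaf NN lv))).
- by rewrite orbF (swap _ (Lhat_iso NN good (vtype_tree NN tv))).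
- by rewrite orbF (swap _ (Rhat_iso NN good (vtype_ret NN rv))).
Qed.

Lemma bool_real (b : bool) : b%:R = 0 :> R \/ b%:R = 1 :> R.
Proof. by case: b; [right|left]. Qed.

Lemma ball_deviation r G :
  `|(\sum_(v : nvert N) `[< rgraph_iso (Defs.ball r (rooted_net v)) G >]%:R) / #|nvert N|%:R
     - limit_law R (fun H => rgraph_iso (Defs.ball r H) G)|
  <= (2 * 4 ^ (r + 5) + 1)%:R * ((disorder (2 * r.+2) N)%:R / n%:R).
Proof.
set S := \sum_v _; rewrite /limit_law.
set bT := `[< rgraph_iso (Defs.ball r Lhat) G >].
set bR := `[< rgraph_iso (Defs.ball r Rhat) G >].
set bL := `[< rgraph_iso (Defs.ball r Nhat_lf) G >].
set l := _ + _ + _.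
(* The value that [S] would have if each vertex had the ball predicted by its type, the root
   counting for 0. It differs from [S] only at bad vertices, and from its limit only through the
   numbers of vertices of each type. *)
pose Sh : R := #|is_tree (@nedge n N)|%:R * bT%:R + (reps N)%:R * bR%:R + n%:R * bL%:R.
have SE : Sh = \sum_(v : nvert N) ((is_tree (@nedge n N) v)%:R * bT%:R
    + (is_ret (@nedge n N) v)%:R * bR%:R + (is_leaf (@nlab n N) v)%:R * bL%:R).
  rewrite !big_split /= -!mulr_suml -!natr_sum !sum_pred.
  by rewrite (card_leaf NN).
have hS : `|S - Sh| <= #|bad_set r N|%:R.
  rewrite SE -sumrB; apply: le_trans (ler_norm_sum _ _ _) _.
  rewrite -(sum_pred (mem (bad_set r N))) natr_sum; apply: ler_sum => v _ /=.
  case: (boolP (v \in bad_set r N)) => [_|gv].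
    have := vertex_types NN v; case: (v == _); case: is_leaf; case: is_tree; case: is_ret => //= _;
      have [->|->] := bool_real `[< rgraph_iso (Defs.ball r (rooted_net v)) G >];
      have [->|->] := bool_real bT;
      have [->|->] := bool_real bR; have [->|->] := bool_real bL;
      by rewrite ler_norml; apply/andP; split; lra.
  rewrite (good_vertex_ball G gv) -/bT -/bR -/bL.
  have := vertex_types NN v; case: (v == _); case: is_leaf; case: is_tree; case: is_ret => //= _;
    by rewrite ?orbF ?mul1r ?mul0r ?addr0 ?add0r ?subr0 ?subrr ?oppr0 ?normr0.
have V0 : #|nvert N|%:R != 0 :> R.
  by rewrite pnatr_eq0 (card_vert NN); lia.
have -> : S / #|nvert N|%:R - l = (S - l * #|nvert N|%:R) / #|nvert N|%:R.
  by rewrite mulrBl mulfK.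
apply: (@deviation_le _ _ _ (#|bad_set r N|%:R + (disorder (2 * r.+2) N)%:R)) => //.
  have -> : S - l * #|nvert N|%:R = (S - Sh) + (Sh - l * #|nvert N|%:R) by lra.
  apply: le_trans (ler_normD _ _) _; apply: lerD hS _.
  rewrite /Sh /l card_tree_real card_vert_real disorderE.
  have /andP[k0 kn] := reps_bounds.
  have b0 : (0 : R) <= #|bad_cycle (2 * r.+2) N|%:R by rewrite ler0n.
  rewrite ler_norml; apply/andP.
  by have [->|->] := bool_real bT; have [->|->] := bool_real bR;
    have [->|->] := bool_real bL; split; lra.
(* The factor 2 stems from the [2 * (n - reps N)] exceptional vertices, the extra 1 from the type
   counts. *)
rewrite -natrD -natrM ler_nat mulnDl mul1n leq_add2r.
apply: leq_trans (card_bad_set r NN) _.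
by rewrite mulnAC mulnC leq_mul2r /disorder; apply/orP; right; lia.
Qed.

End Network.

End Deviation.

(** Markov's inequality turns the mean deviation into a probability. *)
Lemma proportion_cvg (R : realType) (t : vmark) (c : R) :
  (forall n (N : prenet n), (0 < n)%N -> is_network N ->
     `|type_proportion R t N - c| <= 1 * ((disorder 0 N)%:R / n%:R)) ->
  cvg_in_prob (@type_proportion R t) c.
Proof.
move=> dev eps e0; apply: (@cvg_disorder R 0 _ _ eps^-1) => n n0.
rewrite subr0 ger0_norm; last first.
  by rewrite /net_prob /net_mean divr_ge0 ?ler0n // sumr_ge0.
apply: le_trans (net_prob_markov n0 (fun N => type_proportion R t N - c) e0) _.
apply: ler_wpM2l; first by rewrite invr_ge0 ltW.
rewrite -[mean_disorder _ _ _]mul1r; apply: net_mean_disorder => // N NN.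
exact: dev.
Qed.

Theorem theorem1p10 (R : realType) :
  local_weak_cvg (@random_vertex_law R) (@limit_law R)
  /\ [/\ cvg_in_prob (@type_proportion R MTree) (2^-1),
         cvg_in_prob (@type_proportion R MRet) (4^-1) &
         cvg_in_prob (@type_proportion R MLeaf) (4^-1)].
Proof.
split.
  move=> r G _; apply: (@cvg_disorder R (2 * r.+2) _ _ (2 * 4 ^ (r + 5) + 1)%:R) => n n0.
  apply: le_trans (net_mean_dist n0 _ _) _.
  by apply: net_mean_disorder => // N NN; exact: ball_deviation.
split; apply: proportion_cvg => n N n0 NN.
- exact: tree_deviation.
- exact: ret_deviation.
- exact: leaf_deviation.
Qed.
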